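(* Let $P$ be a rank-1 Hermitian projector-valued function on $\overline{\mathbb{C}}$ which is a solution of the Euler-Lagrange equations $[\partial_+\partial_-P,P]=0$ with finite action $S(P)<\infty$, and let $F$ be the associated surface in $su(N)$. At points where $L(P)\neq 0$, the Gaussian curvature $K(F)$ and the mean curvature vector $H(F)$ of the surface satisfy $$K(F)=-\frac{2\,\partial_+\partial_-\ln L(P)}{L(P)},\qquad H(F)=\frac{-4i}{L(P)}[\partial_+P,\partial_-P],\qquad (H(F),H(F))=\frac{4}{L(P)^2}\left(L(P)^2+3\,q(P)^2\right).$$
   Context: Coordinates: $(\xi_1,\xi_2)\in\mathbb{R}^2$, $\xi_\pm=\xi_1\pm i\xi_2$, $\partial_\pm=\partial/\partial\xi_\pm=\frac12\left(\frac{\partial}{\partial \xi_1}\mp i\frac{\partial}{\partial\xi_2}\right)$, $\partial_i=\partial/\partial \xi_i$. $\overline{\mathbb{C}}=\mathbb{C}\cup\{\infty\}$, with differentiability at $\infty$ meant in the coordinate $w_\pm=\xi_\pm^{-1}$. A rank-1 Hermitian projector (function) is an $N\times N$ complex matrix function $P$ of $(\xi_1,\xi_2)$ (sufficiently differentiable, not assumed holomorphic) with $P^2=P$, $P^\dagger=P$, $\mathrm{tr}(P)=1$ pointwise. Lagrangian density: $L(P)=\mathrm{tr}(\partial_+P\,\partial_-P)$. Action: $S(P)=\int_{\mathbb{R}^2}L(P)\,d\xi_1d\xi_2$. Topological charge density: $q(P)=\mathrm{tr}(P\,\partial_+P\,\partial_-P-P\,\partial_-P\,\partial_+P)$. Associated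 surface: $F:\mathbb{R}^2\to su(N)$ is obtained (up to an additive constant) by integrating the closed skew-Hermitian one-form $dF=i\left(-[\partial_+P,P]\,d\xi_++[\partial_-P,P]\,d\xi_-\right)$. The inner product on $su(N)$ is $(A,B)=-\frac12\mathrm{tr}(AB)$; the metric induced on $\mathbb{R}^2$ is $L(P)(d\xi_1^2+d\xi_2^2)$. The mean curvature vector is the trace of the second fundamental form, without factor $\tfrac12$: $H(F)=\frac{1}{L(P)}\left(\partial_1^2F+\partial_2^2F\right)$. *)

(* Defs.v *)
From HB Require Import structures.
From mathcomp Require Import all_boot all_order all_algebra.
From mathcomp Require Import all_classical all_reals all_analysis.
From mathcomp Require Import complex.

Set Implicit Arguments.
Unset Strict Implicit.
Unset Printing Implicit Defensive.

Import Order.TTheory GRing.Theory Num.Theory.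
Import numFieldNormedType.Exports.

Local Open Scope ring_scope.
Local Open Scope complex_scope.
Local Open Scope sesquilinear_scope.

Section Calculus.
Variable R : realType.
Local Notation C := R[i].

Definition xip (x : R * R) : C := x.1 +i* x.2.
Definition xim (x : R * R) : C := x.1 -i* x.2.

Definition evec (i : 'I_2) : R * R := if i == 0 then (1, 0) else (0, 1).

(* A complex-valued function on R^2 is differentiated as a pair of real-valued
   ones, and a matrix-valued function entry by entry.  [derive] is total; it is
   only meaningful where the function is differentiable. *)
Definition dirC (v : R * R) (f : R * R -> C) (x : R * R) : C :=
  'D_v (fun y => complex.Re (f y) : R^o) x +i*
  'D_v (fun y => complex.Im (f y) : R^o) x.

Definition pdR (i : 'I_2) (f : R * R -> R) (x : R * R) : R :=
  'D_(evec i) (f : R * R -> R^o) x.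
Definition pdC (i : 'I_2) (f : R * R -> C) : R * R -> C := dirC (evec i) f.

Definition dpC (f : R * R -> C) (x : R * R) : C :=
  2%:R^-1 * (pdC 0 f x - 'i%C * pdC 1 f x).
Definition dmC (f : R * R -> C) (x : R * R) : C :=
  2%:R^-1 * (pdC 0 f x + 'i%C * pdC 1 f x).

Fixpoint Ck (k : nat) (f : R * R -> R) : Prop :=
  if k is k'.+1 then
    (forall x, differentiable (f : R * R -> R^o) x) /\
    (forall i, Ck k' (pdR i f))
  else continuous f.

Definition CkC (k : nat) (f : R * R -> C) : Prop :=
  Ck k (fun x => complex.Re (f x)) /\ Ck k (fun x => complex.Im (f x)).

Variable N : nat.
Local Notation M := 'M[C]_N.

Definition entrywise (D : (R * R -> C) -> R * R -> C) (A : R * R -> M)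
  (x : R * R) : M := \matrix_(j, k) D (fun y => A y j k) x.

Definition dirM (v : R * R) : (R * R -> M) -> R * R -> M := entrywise (dirC v).
Definition pdM (i : 'I_2) : (R * R -> M) -> R * R -> M := entrywise (pdC i).
Definition dpM : (R * R -> M) -> R * R -> M := entrywise dpC.
Definition dmM : (R * R -> M) -> R * R -> M := entrywise dmC.

Definition CkM (k : nat) (A : R * R -> M) : Prop :=
  forall j k', CkC k (fun x => A x j k').

Definition differentiableM (A : R * R -> M) : Prop :=
  forall j k x,
    differentiable ((fun y => complex.Re (A y j k)) : R * R -> R^o) x /\
    differentiable ((fun y => complex.Im (A y j k)) : R * R -> R^o) x.

Definition commutator (A B : M) : M := A *m B - B *m A.

Definition in_su (A : M) : Prop := A ^t* = - A /\ \tr A = 0.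

(* The trace is real for skew-Hermitian A and B, see [innerE]. *)
Definition inner (A B : M) : R := complex.Re (- (2%:R^-1) * \tr (A *m B)).

End Calculus.

Section Sphere.
Variables (R : realType) (N : nat).
Local Notation C := R[i].
Local Notation M := 'M[C]_N.

(* The point [Some (xi1, xi2)] of the Riemann sphere stands for the complex
   number xi1 + i xi2, and [None] for infinity. *)
Definition sphere : Type := one_point_compactification (R * R).

Definition chart0 (x : R * R) : sphere := Some x.
Definition chartoo (w : R * R) : sphere :=
  if w == (0, 0) then None
  else Some (complex.Re (xip w)^-1, complex.Im (xip w)^-1).

Definition CkSphere (k : nat) (P : sphere -> M) : Prop :=
  CkM k (P \o chart0) /\ CkM k (P \o chartoo).

Definition rank1_projector (A : M) : Prop :=
  [/\ A *m A = A, A ^t* = A & \tr A = 1].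

Definition euler_lagrange (P : R * R -> M) : Prop :=
  forall x, commutator (dpM (dmM P) x) (P x) = 0.

(* For Hermitian P the traces below are real, see [lagrangianE] and
   [topchargeE]. *)
Definition lagrangian (P : R * R -> M) (x : R * R) : R :=
  complex.Re (\tr (dpM P x *m dmM P x)).

Definition topcharge (P : R * R -> M) (x : R * R) : R :=
  complex.Re (\tr (P x *m dpM P x *m dmM P x - P x *m dmM P x *m dpM P x)).

Definition action (P : R * R -> M) : \bar R :=
  (\int[(@lebesgue_measure R) \x (@lebesgue_measure R)]_x (lagrangian P x)%:E)%E.

(* The one-form dF at x, evaluated at the tangent vector v; d xi_+ and d xi_-
   take the values xip v and xim v there. *)
Definition associated_surface (P F : R * R -> M) : Prop :=
  [/\ forall x, in_su (F x),
      differentiableM F &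
      forall x v, dirM v F x =
        'i%C *: (- (xip v *: commutator (dpM P x) (P x))
               + xim v *: commutator (dmM P x) (P x))].

End Sphere.

Section SurfaceGeometry.
Variables (R : realType) (N : nat).
Local Notation C := R[i].
Local Notation M := 'M[C]_N.

Definition fundform1 (F : R * R -> M) (x : R * R) : 'M[R]_2 :=
  \matrix_(i, j) inner (pdM i F x) (pdM j F x).

(* Normal component of the second partial derivatives of F. *)
Definition fundform2 (F : R * R -> M) (i j : 'I_2) (x : R * R) : M :=
  let h := invmx (fundform1 F x) in
  let Fij := pdM i (pdM j F) x in
  Fij - \sum_k \sum_l (h k l * inner Fij (pdM k F x))%:C *: pdM l F x.

(* Trace of the second fundamental form, not divided by 2. *)
Definition mean_curvature (F : R * R -> M) (x : R * R) : M :=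
  \sum_i \sum_j (invmx (fundform1 F x) i j)%:C *: fundform2 F i j x.

Definition christoffel (g : R * R -> 'M[R]_2) (k i j : 'I_2) (x : R * R) : R :=
  2%:R^-1 * \sum_l invmx (g x) k l *
    (pdR i (fun y => g y j l) x + pdR j (fun y => g y i l) x
     - pdR l (fun y => g y i j) x).

(* riemann g l k i j is the coefficient R^l_{kij} given by
   R(e_i, e_j) e_k = \sum_l R^l_{kij} e_l, where
   R(X, Y) = [nabla_X, nabla_Y] - nabla_[X, Y]. *)
Definition riemann (g : R * R -> 'M[R]_2) (l k i j : 'I_2) (x : R * R) : R :=
  pdR i (christoffel g l j k) x - pdR j (christoffel g l i k) x
  + \sum_m (christoffel g m j k x * christoffel g l i m x
            - christoffel g m i k x * christoffel g l j m x).

(* Sectional curvature g(R(e_0, e_1) e_1, e_0) / det g of the metric g. *)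
Definition gauss_curvature_metric (g : R * R -> 'M[R]_2) (x : R * R) : R :=
  (\sum_l g x 0 l * riemann g l 1 0 1 x) / \det (g x).

Definition gauss_curvature (F : R * R -> M) (x : R * R) : R :=
  gauss_curvature_metric (fundform1 F) x.

End SurfaceGeometry.

Section Reality.
Variables (R : realType) (N : nat).
Local Notation C := R[i].
Local Notation M := 'M[C]_N.

Lemma adjointM (A B : M) : (A *m B) ^t* = B ^t* *m A ^t*.
Proof. by rewrite trmx_mul map_mxM. Qed.

Lemma mxtrace_adjoint (A : M) : \tr (A ^t*) = (\tr A)^*.
Proof.
rewrite -[RHS]/(Num.conj _) /mxtrace rmorph_sum.
by apply: eq_bigr => i _; rewrite !mxE.
Qed.

Lemma conjc_fix_Re (z : C) : z^* = z -> (complex.Re z)%:C = z.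
Proof.
case: z => a b /= [] /eqP; rewrite eq_sym -subr_eq0 opprK -mulr2n mulrn_eq0 /=.
by move=> /eqP ->.
Qed.

Lemma innerE (A B : M) : A ^t* = - A -> B ^t* = - B ->
  (inner A B)%:C = - (2%:R^-1) * \tr (A *m B).
Proof.
move=> hA hB; apply: conjc_fix_Re.
have E : (\tr (A *m B))^* = \tr (A *m B).
  by rewrite -mxtrace_adjoint adjointM hA hB mulNmx mulmxN opprK mxtrace_mulC.
by rewrite rmorphM rmorphN fmorphV rmorph_nat /= E.
Qed.

Lemma adjoint_dpM (A : R * R -> M) : (forall x, (A x) ^t* = A x) ->
  differentiableM A -> forall x, (dpM A x) ^t* = dmM A x.
Proof.
move=> hA dA x; apply/matrixP => j k; rewrite !mxE.
have ReE : (fun y => complex.Re (A y k j)) = (fun y => complex.Re (A y j k)).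
  apply/funext => y; rewrite -{1}(hA y) !mxE.
  by case: (A y j k).
have ImE : (fun y => complex.Im (A y k j) : R^o) =
           - (fun y => complex.Im (A y j k) : R^o).
  apply/funext => y; rewrite -{1}(hA y) !mxE.
  by rewrite opprfctE; case: (A y j k).
have dE v : 'D_v (fun y => complex.Im (A y k j) : R^o) x =
            - 'D_v (fun y => complex.Im (A y j k) : R^o) x.
  rewrite ImE deriveN //; apply: diff_derivable.
  by case: (dA j k x).
rewrite /dpC /dmC /pdC /dirC ReE !dE.
rewrite rmorphM fmorphV rmorph_nat; congr (_ * _).
by apply/eqP; rewrite eq_complex /= !mul0r !mul1r !sub0r ?add0r !opprD !opprK !eqxx.
Qed.

Lemma adjoint_dmM (A : R * R -> M) : (forall x, (A x) ^t* = A x) ->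
  differentiableM A -> forall x, (dmM A x) ^t* = dpM A x.
Proof.
by move=> hA dA x; rewrite -(adjoint_dpM hA dA) trmxCK.
Qed.

Lemma lagrangianE (P : R * R -> M) : (forall x, (P x) ^t* = P x) ->
  differentiableM P -> forall x,
  (lagrangian P x)%:C = \tr (dpM P x *m dmM P x).
Proof.
move=> hP dP x; apply: conjc_fix_Re.
by rewrite -mxtrace_adjoint adjointM adjoint_dpM // adjoint_dmM.
Qed.

Lemma topchargeE (P : R * R -> M) : (forall x, (P x) ^t* = P x) ->
  differentiableM P -> forall x,
  (topcharge P x)%:C =
  \tr (P x *m dpM P x *m dmM P x - P x *m dmM P x *m dpM P x).
Proof.
move=> hP dP x; apply: conjc_fix_Re.
rewrite -mxtrace_adjoint linearB /= map_mxB !adjointM hP.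
rewrite (adjoint_dpM hP dP) (adjoint_dmM hP dP).
rewrite !mulmxA !raddfB /=; congr (_ - _).
  by rewrite mxtrace_mulC mulmxA.
by rewrite mxtrace_mulC mulmxA.
Qed.

End Reality.

(* Main.v *)
Require Import Defs.
From HB Require Import structures.
From mathcomp Require Import all_boot all_order all_algebra.
From mathcomp Require Import all_classical all_reals all_analysis.
From mathcomp Require Import complex ring lra.

Import Order.TTheory GRing.Theory Num.Theory.
Import numFieldNormedType.Exports.

(** Write P1 and P2 for the partial derivatives of the projector field [p].  Since
    d xi_+ and d xi_- take the values 1, i and 1, -i on the coordinate vectors, the
    one-form dF says that F_1 = - (P2 p - p P2) and F_2 = P1 p - p P1
    ([surface_partials]), and the Euler-Lagrange equation says that the Laplacian
    of [p] commutes with [p].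

    Differentiating p^2 = p shows that P1 and P2 exchange the range and the kernel
    of [p] ([pdM_offdiagonal]).  For two such matrices, the commutators with [p]
    have the same trace product as the matrices themselves, up to sign, so the
    first fundamental form of [F] is, up to a rotation by a right angle, half the
    Gram matrix of P1, P2.

    The analytic heart is that this form is isothermal:
    tr P1^2 = tr P2^2 and tr (P1 P2) = 0.  The function
    tr P1^2 - tr P2^2 - 2 i tr (P1 P2) is holomorphic by the Euler-Lagrange
    equation, so its real and imaginary parts are harmonic.  As [p] extends smoothly
    over the point at infinity, its first derivatives are O(1 / |xi|^2)
    ([pdM_vanishes]), so these harmonic functions tend to zero at infinity and are
    zero by the maximum principle ([harmonic_vanishing_eq0],
    [hopf_differential_eq0]).

    The metric is then L times the identity ([fundform1_isothermal]).  The
    curvature formula becomes the classical one for isothermal coordinates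
    ([gauss_curvature_conformal]).  The Laplacian of [F] is 2 (P1 P2 - P2 P1), by
    symmetry of the second derivatives of [p].  It commutes with [p], hence it is
    orthogonal to the tangent vectors F_1 and F_2, and it is L times the mean
    curvature vector ([mean_curvature_surface]).  Last, p X p = tr (p X) p because
    [p] has rank one ([rank1_sandwich]); this expresses the trace of
    (P1 P2 - P2 P1)^2 through L and s = tr (p P1 P2), and s^2 = - q^2
    ([rdot_commutator_sq]). *)

Set Implicit Arguments.
Unset Strict Implicit.
Unset Printing Implicit Defensive.

Local Open Scope ring_scope.
Local Open Scope complex_scope.
Local Open Scope sesquilinear_scope.

(** * Differential calculus of real functions on the plane *)

Section PlaneCalculus.
Variable R : realType.
Implicit Types (f g : R * R -> R) (x v : R * R).

Lemma Ck_differentiable k f : Ck k.+1 f -> forall x, differentiable (f : _ -> R^o) x.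
Proof. by move=> []. Qed.

Lemma Ck_pdR k f i : Ck k.+1 f -> Ck k (pdR i f).
Proof. by move=> [_]; apply. Qed.

Lemma Ck_continuous k f : Ck k f -> continuous f.
Proof.
by case: k => // k [df _] x; apply: (@differentiable_continuous _ _ R^o).
Qed.

Lemma CkW k f : Ck k.+1 f -> Ck k f.
Proof.
elim: k f => [|k IH] f; first exact: Ck_continuous.
by move=> [df dd]; split=> // i; apply: IH.
Qed.

Lemma pdRD i f g x : differentiable (f : _ -> R^o) x -> differentiable (g : _ -> R^o) x ->
  pdR i (f \+ g) x = pdR i f x + pdR i g x.
Proof. by move=> df dg; apply: (@deriveD _ _ R^o); apply: diff_derivable. Qed.

Lemma pdRN i f x : differentiable (f : _ -> R^o) x ->
  pdR i (\- f) x = - pdR i f x.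
Proof. by move=> df; apply: (@deriveN _ _ R^o); apply: diff_derivable. Qed.

Lemma pdRM i f g x : differentiable (f : _ -> R^o) x -> differentiable (g : _ -> R^o) x ->
  pdR i (f \* g) x = pdR i f x * g x + f x * pdR i g x.
Proof.
move=> df dg; rewrite /pdR.
rewrite [LHS](@deriveM _ _ f g); [|exact: diff_derivable..].
by rewrite addrC; congr (_ + _); rewrite [LHS]mulrC.
Qed.

Lemma pdR_cst i (c : R) x : pdR i (fun=> c) x = 0.
Proof. exact: (@derive_cst _ _ R^o). Qed.

Lemma Ck_cst k (c : R) : Ck k (fun _ : R * R => c).
Proof.
elim: k c => [|k IH] c; first exact: cst_continuous.
split=> [x|i]; first exact: (@differentiable_cst _ _ R^o).
by rewrite (_ : pdR i _ = fun=> 0) //; apply/funext => x; apply: pdR_cst.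
Qed.

Lemma Ck_add k f g : Ck k f -> Ck k g -> Ck k (f \+ g).
Proof.
elim: k f g => [|k IH] f g /=.
  by move=> cf cg x; apply: (@continuousD _ R^o); [exact: cf|exact: cg].
move=> [df cf] [dg cg]; split=> [x|i]; first exact: (@differentiableD _ _ R^o).
rewrite (_ : pdR i _ = pdR i f \+ pdR i g); first exact: IH.
by apply/funext => x; apply: pdRD.
Qed.

Lemma Ck_opp k f : Ck k f -> Ck k (\- f).
Proof.
elim: k f => [|k IH] f /=.
  by move=> cf x; apply: (@continuousN _ R^o); exact: cf.
move=> [df cf]; split=> [x|i]; first exact: (@differentiableN _ _ R^o).
rewrite (_ : pdR i _ = \- pdR i f); first exact: IH.
by apply/funext => x; apply: pdRN.
Qed.

Lemma Ck_mul k f g : Ck k f -> Ck k g -> Ck k (f \* g).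
Proof.
elim: k f g => [|k IH] f g.
  by move=> cf cg x; apply: continuousM; [exact: cf|exact: cg].
move=> Cf Cg; have [df cf] := Cf; have [dg cg] := Cg.
split=> [x|i]; first exact: differentiableM.
rewrite (_ : pdR i _ = (pdR i f \* g) \+ (f \* pdR i g)).
  by apply: Ck_add; apply: IH; do ?[exact: cf|exact: cg|exact: CkW].
by apply/funext => x; apply: pdRM.
Qed.

Lemma pdR_scale i c (f : R * R -> R) x : differentiable (f : _ -> R^o) x ->
  pdR i (fun y => c * f y) x = c * pdR i f x.
Proof.
move=> df; have dc := Ck_differentiable (Ck_cst 1 c) x.
by have := pdRM i dc df; rewrite pdR_cst mul0r add0r.
Qed.

Lemma pdR_fst i x : pdR i fst x = (evec R i).1.
Proof.
have cf : continuous (fst : R * R -> R^o) by move=> y; exact: cvg_fst.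
rewrite /pdR deriveE; last exact: linear_differentiable.
by rewrite (@diff_lin _ _ R^o (fst : {linear (R * R)%type -> R^o})).
Qed.

Lemma pdR_snd i x : pdR i snd x = (evec R i).2.
Proof.
have cf : continuous (snd : R * R -> R^o) by move=> y; exact: cvg_snd.
rewrite /pdR deriveE; last exact: linear_differentiable.
by rewrite (@diff_lin _ _ R^o (snd : {linear (R * R)%type -> R^o})).
Qed.

Lemma Ck_fst k : Ck k (fst : R * R -> R).
Proof.
have cf : continuous (fst : R * R -> R^o) by move=> x; exact: cvg_fst.
case: k => [//|k]; split=> [x|i]; first exact: linear_differentiable.
rewrite (_ : pdR i _ = fun=> (evec R i).1); first exact: Ck_cst.
by apply/funext => x; apply: pdR_fst.
Qed.

Lemma Ck_snd k : Ck k (snd : R * R -> R).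
Proof.
have cf : continuous (snd : R * R -> R^o) by move=> x; exact: cvg_snd.
case: k => [//|k]; split=> [x|i]; first exact: linear_differentiable.
rewrite (_ : pdR i _ = fun=> (evec R i).2); first exact: Ck_cst.
by apply/funext => x; apply: pdR_snd.
Qed.

Definition sqnorm x : R := x.1 * x.1 + x.2 * x.2.

Lemma Ck_sqnorm k : Ck k sqnorm.
Proof.
have -> : sqnorm = (fst \* fst) \+ (snd \* snd) by [].
by apply: Ck_add; apply: Ck_mul; do ?[exact: Ck_fst|exact: Ck_snd].
Qed.

Lemma pdR_sqnorm i x :
  pdR i sqnorm x = 2 * ((evec R i).1 * x.1 + (evec R i).2 * x.2).
Proof.
have -> : sqnorm = (fst \* fst) \+ (snd \* snd) by [].
have d1 := Ck_differentiable (@Ck_fst 1); have d2 := Ck_differentiable (@Ck_snd 1).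
rewrite pdRD; [|exact: differentiableM..].
rewrite !pdRM // !pdR_fst !pdR_snd; ring.
Qed.

Lemma pdR2_sqnorm i x : pdR i (pdR i sqnorm) x = 2.
Proof.
have d1 := Ck_differentiable (@Ck_fst 1); have d2 := Ck_differentiable (@Ck_snd 1).
have dc (a : R) := Ck_differentiable (Ck_cst 1 a).
have -> : pdR i sqnorm = (fun=> 2) \*
    (((fun=> (evec R i).1) \* fst) \+ ((fun=> (evec R i).2) \* snd)).
  by apply/funext => y; apply: pdR_sqnorm.
rewrite pdR_scale; last by apply: differentiableD; apply: differentiableM.
rewrite pdRD; [|exact: differentiableM..].
rewrite !pdR_scale // pdR_fst pdR_snd /evec.
by case: ifP => _ /=; ring.
Qed.

Lemma norm_evec i : `|evec R i| = 1 :> R.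
Proof.
rewrite /evec; case: ifP => _; rewrite prod_normE /= normr1 normr0.
  by apply/max_idPl.
by apply/max_idPr.
Qed.

Lemma is_derive_line f x v (t : R) :
  derivable (f : R * R -> R^o) (x + t *: v) v ->
  is_derive t 1 (fun s : R => f (x + s *: v) : R^o) ('D_v (f : _ -> R^o) (x + t *: v)).
Proof.
move=> df.
have E : (fun h : R => h^-1 *: (f (h *: v + (x + t *: v)) - f (x + t *: v) : R^o)) =
   (fun h : R => h^-1 *: (f (x + (h *: 1 + t) *: v) - f (x + t *: v) : R^o)).
  apply/funext => h; congr (_ *: (f _ - _)).
  by rewrite scalerDl [h *: 1]mulr1 addrCA.
apply: DeriveDef.
  by move: df; rewrite /derivable /= E.
by rewrite /derive /= -E.
Qed.

Lemma is_derive_axis f i x (t : R) :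
  (forall y, differentiable (f : _ -> R^o) y) ->
  is_derive t 1 (fun s : R => f (x + s *: evec R i) : R^o)
    (pdR i f (x + t *: evec R i) : R^o).
Proof. by move=> df; apply: is_derive_line; apply: diff_derivable. Qed.

Lemma mvt (phi dphi : R -> R) (h : R) : 0 < h ->
  (forall t : R, is_derive t 1 (phi : R -> R^o) (dphi t : R^o)) ->
  exists2 s, 0 < s < h & phi h - phi 0 = dphi s * h.
Proof.
move=> h0 dphiP.
have [|s] := @MVT R phi dphi 0 h h0 (fun t _ => dphiP t).
  apply: continuous_subspaceT => t.
  by apply: (@differentiable_continuous _ _ R^o); apply/derivable1_diffP.
by rewrite subr0 in_itv => sh E; exists s.
Qed.

Lemma mvt_axis f x i (h : R) :
  (forall y, differentiable (f : _ -> R^o) y) -> 0 < h ->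
  exists2 s, 0 < s < h &
    f (x + h *: evec R i) - f x = pdR i f (x + s *: evec R i) * h.
Proof.
move=> df h0.
have [s sh] := mvt h0 (fun t => is_derive_axis i x t df).
by rewrite scale0r addr0; exists s.
Qed.

(** The mean value theorem, used once in each direction.  The left-hand side is
    symmetric in [i] and [j], so that letting [h] tend to zero gives the symmetry
    of the second derivatives. *)
Lemma square_increment f x i j (h : R) : Ck 2 f -> 0 < h ->
  exists s t : R, [/\ 0 < s < h, 0 < t < h &
    f (x + h *: evec R i + h *: evec R j) - f (x + h *: evec R i)
    - f (x + h *: evec R j) + f x =
    h * h * pdR j (pdR i f) (x + s *: evec R i + t *: evec R j)].
Proof.
move=> Cf h0; set ei := evec R i; set ej := evec R j.
have df := Ck_differentiable Cf.
have dfi := Ck_differentiable (Ck_pdR i Cf).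
pose phi u := f (x + h *: ej + u *: ei) - f (x + u *: ei).
pose dphi u := pdR i f (x + h *: ej + u *: ei) - pdR i f (x + u *: ei).
have dphiP (u : R) : is_derive u 1 (phi : R -> R^o) (dphi u : R^o).
  by apply: (@is_deriveB _ _ R^o); apply: is_derive_axis.
have [s s_h Es] := mvt h0 dphiP.
have [t t_h Et] := mvt_axis (x + s *: ei) j dfi h0.
exists s, t; split=> //; move: Es; rewrite /phi scale0r !addr0 => Es.
rewrite -mulrA [h * pdR _ _ _]mulrC -Et (addrAC x (s *: ei)).
by rewrite -[X in h * X]/(dphi s) mulrC -Es (addrAC x (h *: ei)); ring.
Qed.

Lemma continuous_near f x (e : R) : continuous f -> 0 < e ->
  exists2 d, 0 < d & forall y, `|x - y| < d -> `|f x - f y| < e.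
Proof.
move=> cf e0; have := cf x.
move/cvgrPdist_lt => /(_ e e0) /nbhs_normP [d d0 H].
by exists d => // y hy; apply: H.
Qed.

Theorem schwarz f i j x : Ck 2 f -> pdR i (pdR j f) x = pdR j (pdR i f) x.
Proof.
move=> Cf; apply/eqP; rewrite -subr_eq0 -normr_le0; apply/ler_addgt0Pl => e e0.
rewrite addr0.
have cij : continuous (pdR i (pdR j f)) by apply: (@Ck_continuous 0); do 2!apply: Ck_pdR.
have cji : continuous (pdR j (pdR i f)) by apply: (@Ck_continuous 0); do 2!apply: Ck_pdR.
have e2 : 0 < e / 2 by rewrite divr_gt0.
have [d1 d10 H1] := @continuous_near _ x _ cij e2.
have [d2 d20 H2] := @continuous_near _ x _ cji e2.
(* The points of the square of side h lie within 2 h of x. *)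
pose h := Num.min d1 d2 / 3.
have m0 : 0 < Num.min d1 d2 by rewrite lt_min d10 d20.
have h0 : 0 < h by rewrite divr_gt0.
have close k l s t : 0 < s < h -> 0 < t < h ->
    `|x - (x + s *: evec R k + t *: evec R l)| < Num.min d1 d2.
  move=> /andP[s0 sh] /andP[t0 th].
  rewrite -addrA opprD addrA subrr sub0r normrN.
  apply: (le_lt_trans (ler_normD _ _)); rewrite !normrZ (gtr0_norm s0) (gtr0_norm t0).
  have := ltrD sh th; rewrite !norm_evec !mulr1 => /lt_le_trans; apply.
  by rewrite /h; lra.
have [s [t [hs ht E1]]] := square_increment x j i Cf h0.
have [s' [t' [hs' ht' E2]]] := square_increment x i j Cf h0.
have E : pdR i (pdR j f) (x + s *: evec R j + t *: evec R i) =
         pdR j (pdR i f) (x + s' *: evec R i + t' *: evec R j).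
  apply: (@mulfI _ (h * h)); first by rewrite mulf_neq0 ?gt_eqF.
  apply: (etrans (esym E1)); apply: etrans E2.
  by rewrite (addrAC x (h *: evec R j)) (addrAC _ (- f (x + h *: evec R j))).
have := H1 _ (lt_le_trans (close j i s t hs ht) _).
have := H2 _ (lt_le_trans (close i j s' t' hs' ht') _).
rewrite !ge_min !lexx orbT => /(_ isT) B2 /(_ isT) B1.
rewrite -E in B2; rewrite distrC in B2.
apply: (le_trans (ler_distD (pdR i (pdR j f) (x + s *: evec R j + t *: evec R i)) _ _)).
by rewrite (splitr e); apply: lerD; apply: ltW; [exact: B1|exact: B2].
Qed.

End PlaneCalculus.

(** * Harmonic functions vanishing at infinity *)

(* Derivatives are handled through the rules above, not as limits. *)
Local Opaque derive Ck.

Section HarmonicFunctions.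
Variable R : realType.
Implicit Types (f g : R * R -> R) (x v : R * R).

Lemma pdR_max f x i (d : R) : (forall y, differentiable (f : _ -> R^o) y) -> 0 < d ->
  (forall y, `|x - y| < d -> f y <= f x) -> pdR i f x = 0.
Proof.
move=> df d0 fx; pose phi u := f (x + u *: evec R i).
have dphi (u : R) : is_derive u 1 (phi : R -> R^o) (pdR i f (x + u *: evec R i) : R^o).
  by apply: is_derive_axis.
have : is_derive (0 : R) 1 (phi : R -> R^o) 0.
  apply: (@derive1_at_max _ phi (- d) d).
  - lra.
  - by move=> t _; apply: ex_derive.
  - by rewrite in_itv /=; apply/andP; split; lra.
  - move=> t; rewrite in_itv /= => /andP[t1 t2]; rewrite /phi scale0r addr0.
    apply: fx; rewrite opprD addrA subrr sub0r normrN normrZ norm_evec mulr1.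
    by rewrite ltr_norml t1.
move=> [_ E]; have [_] := dphi 0; rewrite E scale0r addr0 => ->//.
Qed.

(** Otherwise the first derivative, which vanishes at [x], is positive just after
    [x], and [f] increases there. *)
Lemma pdR2_max f x i (d : R) : Ck 2 f -> 0 < d ->
  (forall y, `|x - y| < d -> f y <= f x) -> pdR i (pdR i f) x <= 0.
Proof.
move=> Cf d0 fx; rewrite leNgt; apply/negP => f2.
have df := Ck_differentiable Cf.
have dfi := Ck_differentiable (Ck_pdR i Cf).
have cii : continuous (pdR i (pdR i f)).
  by apply: (@Ck_continuous _ 0); do 2!apply: Ck_pdR.
have fi0 : pdR i f x = 0 by apply: pdR_max fx.
have [d' d'0 Hd'] := @continuous_near _ _ x _ cii f2.
pose h := Num.min d d' / 2.
have m0 : 0 < Num.min d d' by rewrite lt_min d0 d'0.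
have h0 : 0 < h by rewrite /h; lra.
have hm : h < Num.min d d' by rewrite /h; lra.
have [hd hd'] : h < d /\ h < d' by move: hm; rewrite lt_min => /andP.
have near (t : R) : 0 < t <= h -> `|x - (x + t *: evec R i)| = t.
  move=> /andP[t0 _].
  by rewrite opprD addrA subrr sub0r normrN normrZ norm_evec mulr1 gtr0_norm.
have [s /andP[s0 sh] E] := mvt_axis x i df h0.
have [t /andP[t0 ts] E'] := mvt_axis x i dfi s0.
have P : 0 < pdR i (pdR i f) (x + t *: evec R i).
  have : `|x - (x + t *: evec R i)| < d'.
    by rewrite near ?t0 ?(ltW (lt_trans ts sh)) // (lt_trans ts) // (lt_trans sh).
  by move/Hd'; rewrite ltr_norml ltrBlDr ltrDl => /andP[].
have Q : 0 < f (x + h *: evec R i) - f x.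
  rewrite E mulr_gt0 //; rewrite fi0 subr0 in E'; by rewrite E' mulr_gt0.
have : f (x + h *: evec R i) <= f x by apply: fx; rewrite near ?h0 ?lexx.
by rewrite -subr_le0 leNgt Q.
Qed.

Definition vanishes_at_infinity f :=
  forall e : R, 0 < e -> exists r : R, forall x, r <= `|x| -> `|f x| <= e.

Lemma vanishesN f : vanishes_at_infinity f -> vanishes_at_infinity (\- f).
Proof. by move=> van e /van [r Hr]; exists r => x /Hr; rewrite normrN. Qed.

Lemma vanishes_add f g : vanishes_at_infinity f ->
  vanishes_at_infinity g -> vanishes_at_infinity (fun x => f x + g x).
Proof.
move=> vf vg e e0; have e2 : 0 < e / 2 by rewrite divr_gt0.
have [r Hr] := vf _ e2; have [s Hs] := vg _ e2; exists (Num.max r s) => x.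
rewrite ge_max => /andP[/Hr rx /Hs sx].
by rewrite (splitr e); apply: (le_trans (ler_normD _ _)); apply: lerD.
Qed.

Lemma vanishes_mul f g : vanishes_at_infinity f ->
  vanishes_at_infinity g -> vanishes_at_infinity (fun x => f x * g x).
Proof.
move=> vf vg e e0; have [r Hr] := vf _ e0; have [s Hs] := vg _ ltr01.
exists (Num.max r s) => x; rewrite ge_max => /andP[/Hr rx /Hs sx].
by rewrite normrM -[e]mulr1; apply: ler_pM.
Qed.

Lemma vanishes_sum (I : Type) (r : seq I) (h : I -> R * R -> R) :
  (forall j, vanishes_at_infinity (h j)) ->
  vanishes_at_infinity (fun x => \sum_(j <- r) h j x).
Proof.
move=> vh; elim: r => [|j r IH].
  by move=> e e0; exists 0 => x _; rewrite big_nil normr0 ltW.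
by under eq_fun do rewrite big_cons; apply: vanishes_add.
Qed.

Lemma compact_box (r : R) : compact [set x : R * R | `|x| <= r]%classic.
Proof.
have -> : [set x : R * R | `|x| <= r]%classic = (`[- r, r] `*` `[- r, r])%classic.
  apply/seteqP; split=> [] [a b] /=; rewrite prod_normE /= ge_max !in_itv /= !ler_norml.
    by move/andP.
  by move=> [-> ->].
by apply: compact_setX; exact: segment_compact.
Qed.

(** Weak maximum principle.  If f x0 = c > 0, then adding e |x|^2 with e > 0 small
    to [f] gives a function whose maximum on a large box is not attained on the
    boundary, where [f] is at most c / 2; at an interior maximum the Laplacian is
    at most 0, but it equals 4 e. *)
Lemma harmonic_le0 f : Ck 2 f ->
  (forall x, pdR 0 (pdR 0 f) x + pdR 1 (pdR 1 f) x = 0) ->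
  vanishes_at_infinity f -> forall x, f x <= 0.
Proof.
move=> Cf harm van x0; rewrite leNgt; apply/negP => c0.
pose c := f x0; have c20 : 0 < c / 2 by rewrite divr_gt0.
have [r0 Hr0] := van _ c20.
pose r := Num.max r0 (`|x0| + 1).
have r00 : r0 <= r by rewrite /r le_max lexx.
have rx0 : `|x0| + 1 <= r by rewrite /r le_max lexx orbT.
have nx0 : 0 <= `|x0| := normr_ge0 _.
have rp : 0 < r by lra.
(* On the box |x|^2 is at most 2 r^2, so e |x|^2 is at most c / 4. *)
pose e := c / (8 * (r * r)).
have e0 : 0 < e by rewrite divr_gt0 // mulr_gt0 // mulr_gt0.
pose v := f \+ ((fun=> e) \* @sqnorm R).
have Ce : Ck 2 ((fun=> e) \* @sqnorm R) := Ck_mul (Ck_cst 2 e) (@Ck_sqnorm R 2).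
have Cv : Ck 2 v := Ck_add Cf Ce.
have xb : `|x0| <= r by lra.
have [y yb ymax] := @compact_EVT_max _ R v [set x : R * R | `|x| <= r]%classic
  (ex_intro _ x0 xb) (@compact_box r) (continuous_subspaceT (Ck_continuous Cv)).
have vE z : v z = f z + e * (z.1 * z.1 + z.2 * z.2) by [].
have sq0 (a : R) : 0 <= a * a by rewrite -expr2 sqr_ge0.
have vx0 : c <= v x0.
  by rewrite vE -/c lerDl mulr_ge0 ?(ltW e0) // addr_ge0.
have vy : c <= v y by apply: (le_trans vx0); apply: ymax; rewrite inE /=; lra.
rewrite inE /= in yb.
have yr : `|y| < r.
  rewrite lt_neqAle yb andbT; apply/eqP => yE.
  have fy : f y <= c / 2 by apply: (le_trans (ler_norm _)); apply: Hr0; rewrite yE.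
  have [y1 y2] : `|y.1| <= r /\ `|y.2| <= r.
    by move: yb; rewrite prod_normE ge_max => /andP.
  have sq (a : R) : `|a| <= r -> a * a <= r * r.
    by move=> ar; rewrite -(ger0_norm (sq0 a)) normrM; apply: ler_pM.
  have : e * (y.1 * y.1 + y.2 * y.2) <= c / 4.
    apply: (@le_trans _ _ (e * (r * r + r * r))).
      by rewrite ler_pM2l //; apply: lerD; apply: sq.
    have -> : e * (r * r + r * r) = c / 4; last by [].
    by rewrite /e; field; rewrite gt_eqF.
  by move: vy c20 fy; rewrite vE; clear; lra.
have loc z : `|y - z| < r - `|y| -> v z <= v y.
  move=> yz; apply: ymax; rewrite inE /=.
  by have := ler_distD y 0 z; rewrite !sub0r !normrN; lra.
have d0 : 0 < r - `|y| by lra.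
have dsq := Ck_differentiable (@Ck_sqnorm R 1).
have dv i : pdR i v = pdR i f \+ ((fun=> e) \* pdR i (@sqnorm R)).
  apply/funext => z.
  rewrite (pdRD i (Ck_differentiable Cf z) (Ck_differentiable Ce z)).
  by rewrite (pdR_scale i e (dsq z)).
have ddv i z : pdR i (pdR i v) z = pdR i (pdR i f) z + 2 * e.
  have dd : differentiable (pdR i (@sqnorm R) : _ -> R^o) z.
    exact: Ck_differentiable (Ck_pdR i (@Ck_sqnorm R 2)) z.
  have dc := Ck_differentiable (@Ck_cst R 1 e) z.
  rewrite dv (pdRD i (Ck_differentiable (Ck_pdR i Cf) z) (differentiableM dc dd)).
  by rewrite (pdR_scale i e dd) pdR2_sqnorm mulrC.
have := pdR2_max 0 Cv d0 loc; have := pdR2_max 1 Cv d0 loc.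
rewrite !ddv; move: (harm y) e0.
move: (pdR 0 (pdR 0 f) y) (pdR 1 (pdR 1 f) y) (e) => a b e'; clear; lra.
Qed.

Theorem harmonic_vanishing_eq0 f : Ck 2 f ->
  (forall x, pdR 0 (pdR 0 f) x + pdR 1 (pdR 1 f) x = 0) ->
  vanishes_at_infinity f -> forall x, f x = 0.
Proof.
move=> Cf harm van x; apply/eqP; rewrite eq_le harmonic_le0 //=.
rewrite -oppr_le0; apply: (@harmonic_le0 (\- f)); [exact: Ck_opp| |exact: vanishesN].
move=> y.
have dN i : pdR i (\- f) = \- pdR i f.
  by apply/funext => z; apply: pdRN; apply: Ck_differentiable Cf z.
rewrite !dN !pdRN; first by rewrite -opprD harm oppr0.
all: by apply: (@Ck_differentiable _ 0); apply: Ck_pdR.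
Qed.

End HarmonicFunctions.

(** * Decay of first derivatives from smoothness at infinity *)

Section Decay.
Variable R : realType.
Implicit Types (f g : R * R -> R) (x v : R * R).

Lemma pdRV i f x : differentiable (f : _ -> R^o) x -> f x != 0 ->
  pdR i (fun y => (f y)^-1) x = - (pdR i f x / f x ^+ 2).
Proof.
move=> df f0; rewrite /pdR.
rewrite [LHS](@deriveV _ _ f); [|done|exact: diff_derivable].
by rewrite scaleNr [_ *: _]mulrC.
Qed.

(** The map xi |-> 1 / xi in real coordinates. *)
Definition inversion x : R * R := (x.1 / sqnorm x, - x.2 / sqnorm x).

Lemma sqnorm_ge x : `|x| * `|x| <= sqnorm x.
Proof.
have sq0 (a : R) : 0 <= a * a by rewrite -expr2 sqr_ge0.
rewrite -expr2 /sqnorm prod_normE /=.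
have h1 : `|x.1| ^+ 2 = x.1 * x.1 by rewrite -normrX ger0_norm ?sqr_ge0.
have h2 : `|x.2| ^+ 2 = x.2 * x.2 by rewrite -normrX ger0_norm ?sqr_ge0.
rewrite /Num.max; case: ifP => _; rewrite ?h1 ?h2.
  by rewrite lerDr.
by rewrite lerDl.
Qed.

Lemma sqnorm_gt0 x : x != 0 -> 0 < sqnorm x.
Proof.
move=> x0; apply: lt_le_trans (sqnorm_ge x).
by rewrite mulr_gt0 // normr_gt0.
Qed.

Lemma inversion_chartoo x : x != 0 -> chartoo (inversion x) = Some x.
Proof.
move=> x0; have q0 := sqnorm_gt0 x0; have qn0 : sqnorm x != 0 by rewrite gt_eqF.
rewrite /chartoo; case: eqP => [[/eqP E1 /eqP E2]|_].
  move: E1 E2; rewrite !mulf_eq0 oppr_eq0 invr_eq0 (negPf qn0) !orbF => /eqP a0 /eqP b0.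
  by case/eqP: x0; rewrite [LHS]surjective_pairing a0 b0.
congr Some; rewrite [RHS]surjective_pairing.
rewrite /xip /inversion /=.
have qE : (x.1 / sqnorm x) ^+ 2 + (- x.2 / sqnorm x) ^+ 2 = (sqnorm x)^-1.
  apply: (mulIf qn0); rewrite mulVf // !expr2 /sqnorm; field.
  exact: qn0.
rewrite qE; congr pair; rewrite invrK; field; exact: qn0.
Qed.

Lemma diff_coord f x v : differentiable (f : _ -> R^o) x ->
  'D_v (f : _ -> R^o) x = v.1 * pdR 0 f x + v.2 * pdR 1 f x.
Proof.
move=> df; rewrite /pdR !deriveE //.
have -> : v = v.1 *: evec R 0 + v.2 *: evec R 1.
  rewrite /evec /= [LHS]surjective_pairing; congr pair => /=; rewrite /GRing.scale /=; ring.
rewrite linearD !linearZ /=; congr (_ * _ + _ * _); rewrite /GRing.scale /=; ring.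
Qed.

Lemma near_norm x (d : R) (Q : R * R -> Prop) : 0 < d ->
  (forall y, `|x - y| < d -> Q y) -> \forall y \near x, Q y.
Proof.
move=> d0 H; apply: (proj2 (@nbhs_normP R (R * R)%type x Q)).
by exists d.
Qed.

(** The chain rule for xi |-> g (1 / xi), in coordinates. *)
Lemma pdR_inversion g f i x : x != 0 ->
  (forall y, differentiable (g : _ -> R^o) y) ->
  (forall y, y != 0 -> f y = g (inversion y)) ->
  pdR i f x = pdR i (fun y => y.1 / sqnorm y) x * pdR 0 g (inversion x)
    + pdR i (fun y => - y.2 / sqnorm y) x * pdR 1 g (inversion x).
Proof.
move=> x0 dg fg.
have q0 : sqnorm x != 0 by rewrite gt_eqF // sqnorm_gt0.
have d1 := Ck_differentiable (@Ck_fst R 1); have d2 := Ck_differentiable (@Ck_snd R 1).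
have dq := Ck_differentiable (@Ck_sqnorm R 1).
have dqV : differentiable ((fun y => (sqnorm y)^-1) : _ -> R^o) x by apply: differentiableV.
have di1 : differentiable ((fun y => y.1 / sqnorm y) : _ -> R^o) x by apply: differentiableM.
have di2 : differentiable ((fun y => - y.2 / sqnorm y) : _ -> R^o) x.
  by apply: differentiableM => //; apply: differentiableN.
have di : differentiable inversion x by apply: differentiable_pair.
have -> : pdR i f x = 'D_(evec R i) (g \o inversion : _ -> R^o) x.
  apply: near_eq_derive; have x0' : 0 < `|x| by rewrite normr_gt0.
  apply: (near_norm x0') => y xy; apply: fg; apply: contraTneq xy => ->.
  by rewrite subr0 ltxx.
rewrite deriveE; last exact: differentiable_comp.
rewrite diff_comp //=.
rewrite -[LHS](@deriveE _ _ R^o g) // diff_coord //.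
rewrite (diff_pair di1 di2) /=.
by rewrite /pdR !deriveE.
Qed.

Lemma pdR_inversion_bound i x : x != 0 ->
  `|pdR i (fun y => y.1 / sqnorm y) x| <= 3 / sqnorm x /\
  `|pdR i (fun y => - y.2 / sqnorm y) x| <= 3 / sqnorm x.
Proof.
move=> x0; have qp := sqnorm_gt0 x0.
have q0 : sqnorm x != 0 by rewrite gt_eqF.
have d1 := Ck_differentiable (@Ck_fst R 1); have d2 := Ck_differentiable (@Ck_snd R 1).
have dq := Ck_differentiable (@Ck_sqnorm R 1).
have dqV : differentiable ((fun y => (sqnorm y)^-1) : _ -> R^o) x by apply: differentiableV.
have dN : differentiable ((fun y => - y.2) : _ -> R^o) x by apply: differentiableN.
have pN : pdR i (fun y => - y.2) x = - (evec R i).2 by rewrite pdRN // pdR_snd.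
have key (a b : R) : `|a| <= 1 -> `|b| <= sqnorm x ->
    `|a / sqnorm x - 2 * b / sqnorm x ^+ 2| <= 3 / sqnorm x.
  move=> ha hb.
  have -> : a / sqnorm x - 2 * b / sqnorm x ^+ 2 = (a - 2 * (b / sqnorm x)) / sqnorm x.
    by field; exact: q0.
  rewrite normrM [X in _ * X]gtr0_norm ?invr_gt0 //.
  rewrite ler_pM2r ?invr_gt0 //; apply: (le_trans (ler_normB _ _)).
  have : `|b / sqnorm x| <= 1.
    by rewrite normrM [X in _ * X]gtr0_norm ?invr_gt0 // ler_pdivrMr // mul1r.
  rewrite [`|2 * _|]normrM (@ger0_norm _ 2) //; lra.
have [h1 h2] : `|x.1| <= `|x| /\ `|x.2| <= `|x|.
  by rewrite prod_normE !le_max !lexx orbT.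
have hh (a b : R) : `|a| <= `|x| -> `|b| <= `|x| -> `|a * b| <= sqnorm x.
  by move=> ha hb; rewrite normrM; apply: le_trans (sqnorm_ge x); apply: ler_pM.
have [e1 e2] : `|(evec R i).1| <= 1 /\ `|(evec R i).2| <= 1.
  by rewrite /evec; case: ifP => _ /=; rewrite normr0 normr1 ler01 lexx.
have ei : (evec R i).1 * x.1 + (evec R i).2 * x.2 = if i == 0 then x.1 else x.2.
  by rewrite /evec; case: ifP => _ /=; ring.
have hi : `|if i == 0 then x.1 else x.2| <= `|x| by case: ifP.
split.
  rewrite (pdRM i (d1 x) dqV) pdR_fst pdRV // pdR_sqnorm ei.
  have := key _ _ e1 (hh _ _ h1 hi).
  by congr (`|_| <= _); field; exact: q0.
rewrite (pdRM i dN dqV) pN pdRV // pdR_sqnorm ei.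
have e2' : `|- (evec R i).2| <= 1 by rewrite normrN.
have h2' : `|- x.2| <= `|x| by rewrite normrN.
have := key _ _ e2' (hh _ _ h2' hi).
by congr (`|_| <= _); field; exact: q0.
Qed.

Lemma norm_inversion x : x != 0 -> `|inversion x| <= `|x|^-1.
Proof.
move=> x0; have qp := sqnorm_gt0 x0.
have xp : 0 < `|x| by rewrite normr_gt0.
have [h1 h2] : `|x.1| <= `|x| /\ `|x.2| <= `|x|.
  by rewrite prod_normE !le_max !lexx orbT.
have key (a : R) : `|a| <= `|x| -> `|a / sqnorm x| <= `|x|^-1.
  move=> ha; rewrite normrM [X in _ * X]gtr0_norm ?invr_gt0 // ler_pdivrMr //.
  rewrite mulrC ler_pdivlMr //; apply: le_trans (sqnorm_ge x).
  by rewrite ler_pM2r.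
by rewrite prod_normE ge_max; apply/andP; split; apply: key; rewrite ?normrN.
Qed.

Lemma bounded_near f x : continuous f ->
  exists d B : R, [/\ 0 < d, 0 <= B & forall y, `|x - y| < d -> `|f y| <= B].
Proof.
move=> cf; have [d d0 Hd] := continuous_near x cf ltr01.
exists d, (`|f x| + 1); split=> // y /Hd fxy.
rewrite -[f y](subKr (f x)); apply: (le_trans (ler_normB _ _)).
by rewrite lerD2l ltW.
Qed.

(** The derivative of 1 / xi is O(1 / |xi|^2), and the derivatives of [g] are
    bounded near 0. *)
Lemma pdR_vanishes f g i : Ck 1 g ->
  (forall y, y != 0 -> f y = g (inversion y)) ->
  vanishes_at_infinity (pdR i f).
Proof.
move=> Cg fg e e0.
have [d0 [B0 [d0p B0p H0]]] := bounded_near 0 (Ck_continuous (Ck_pdR 0 Cg)).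
have [d1 [B1 [d1p B1p H1]]] := bounded_near 0 (Ck_continuous (Ck_pdR 1 Cg)).
exists (1 + d0^-1 + d1^-1 + 3 * (B0 + B1) / e) => x xr.
have p0 : 0 < d0^-1 by rewrite invr_gt0.
have p1 : 0 < d1^-1 by rewrite invr_gt0.
have p2 : 0 <= 3 * (B0 + B1) / e.
  by apply: divr_ge0; rewrite ?(ltW e0) // mulr_ge0 // addr_ge0.
have [x1 xd0 xd1 xB] : [/\ 1 <= `|x|, d0^-1 < `|x|, d1^-1 < `|x| &
    3 * (B0 + B1) / e <= `|x|].
  by move: xr p0 p1 p2; clear; move=> *; split; lra.
have xp : 0 < `|x| := lt_le_trans ltr01 x1.
have x0 : x != 0 by rewrite -normr_gt0.
have qp := sqnorm_gt0 x0.
have small d : 0 < d -> d^-1 < `|x| -> `|0 - inversion x| < d.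
  move=> dp dx; rewrite sub0r normrN; apply: (le_lt_trans (norm_inversion x0)).
  by rewrite -(invrK d) ltf_pV2 // posrE invr_gt0.
have b0 := H0 _ (small _ d0p xd0).
have b1 := H1 _ (small _ d1p xd1).
rewrite (pdR_inversion i x0 (Ck_differentiable Cg) fg).
have [k1 k2] := pdR_inversion_bound i x0.
apply: (@le_trans _ _ (3 / sqnorm x * B0 + 3 / sqnorm x * B1)).
  apply: (le_trans (ler_normD _ _)); rewrite !normrM.
  by apply: lerD; apply: ler_pM; [| |exact: k1|exact: b0| | |exact: k2|exact: b1].
have -> : 3 / sqnorm x * B0 + 3 / sqnorm x * B1 = 3 * (B0 + B1) / sqnorm x.
  by move: (sqnorm x) => q; ring.
rewrite ler_pdivrMr // [e * _]mulrC -ler_pdivrMr //.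
apply: le_trans (sqnorm_ge x); apply: (le_trans xB).
by rewrite ler_peMl // ltW.
Qed.

End Decay.

(** * Algebra of rank-one projectors *)

Section ProjectorAlgebra.
Variables (K : numFieldType) (N : nat).
Local Notation M := 'M[K]_N.
Implicit Types A B X Q : M.

(** A full-rank factorization Q = c b satisfies b c = 1, so that the rank of Q is
    its trace; hence the rank is 1 and b X c is a scalar. *)
Lemma rank1_sandwich Q X : Q *m Q = Q -> \tr Q = 1 ->
  Q *m X *m Q = \tr (Q *m X) *: Q.
Proof.
move=> QQ tQ.
move: (col_base Q) (row_base Q) (mulmx_base Q) (col_base_full Q) (row_base_free Q).
move=> c b QE cfull bfree.
have bc : b *m c = 1%:M.
  apply: (row_free_inj bfree); apply: (row_full_inj cfull).
  by rewrite /= mul1mx !mulmxA QE -[LHS]mulmxA QE QQ.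
have r1 : \rank Q = 1%N.
  apply/eqP; rewrite -(eqr_nat K); apply/eqP.
  by rewrite -[RHS]tQ -[in RHS]QE mxtrace_mulC bc mxtrace1.
move: c b QE bc {cfull bfree}; rewrite r1 => c b QE bc.
rewrite -QE -(mulmxA c b X) mxtrace_mulC.
have -> : c *m (b *m X) *m (c *m b) = c *m (b *m X *m c) *m b by rewrite !mulmxA.
move: (b *m X *m c) => y.
by rewrite [y]mx11_scalar (mul_mx_scalar (y 0 0) c) -scalemxAl mxtrace_scalar mulr1n.
Qed.

(** Differentiating Q^2 = Q gives this equation: these are the tangent vectors at
    Q to the set of projectors, and they exchange the range and the kernel of Q. *)
Definition offdiagonal Q A := Q *m A + A *m Q = A.

Variable Q : M.
Hypothesis QQ : Q *m Q = Q.

Lemma offdiagonal_sandwich A : offdiagonal Q A -> Q *m A *m Q = 0.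
Proof.
move=> hA; have := congr1 (fun Y => Q *m Y *m Q) hA.
rewrite /= mulmxDr mulmxDl !mulmxA QQ -!mulmxA QQ => /eqP.
by rewrite -subr_eq0 addrK => /eqP.
Qed.

Lemma offdiagonal_mull A : offdiagonal Q A -> Q *m A = A - A *m Q.
Proof. by move=> {2}<-; rewrite addrK. Qed.

Lemma offdiagonal_mul_comm A B : offdiagonal Q A -> offdiagonal Q B ->
  Q *m (A *m B) = A *m B *m Q.
Proof.
move=> hA hB; rewrite mulmxA offdiagonal_mull // mulmxBl -(mulmxA A Q B).
by rewrite (offdiagonal_mull hB) mulmxBr opprB addrC subrK mulmxA.
Qed.

Lemma commutator_comm A B : offdiagonal Q A -> offdiagonal Q B ->
  Q *m (A *m B - B *m A) = (A *m B - B *m A) *m Q.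
Proof.
by move=> hA hB; rewrite mulmxBr mulmxBl !offdiagonal_mul_comm.
Qed.

Lemma trace_comm_commutator X Y : Q *m X = X *m Q -> \tr (X *m (Y *m Q - Q *m Y)) = 0.
Proof.
move=> QX; rewrite mulmxBr linearB /= (mulmxA X Q) -QX -(mulmxA Q X).
by rewrite [\tr (Q *m _)]mxtrace_mulC mulmxA subrr.
Qed.

Lemma trace_comm_offdiagonal X A : Q *m X = X *m Q -> offdiagonal Q A ->
  \tr (X *m A) = 0.
Proof.
move=> QX hA; rewrite -hA mulmxDr linearD /=.
have E : \tr (X *m (A *m Q)) = \tr (X *m (Q *m A)).
  by rewrite (mulmxA X A Q) mxtrace_mulC (mulmxA Q X A) QX (mulmxA X Q A).
suff T0 : \tr (X *m (Q *m A)) = 0 by rewrite E T0 addr0.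
have -> : X *m (Q *m A) = Q *m (X *m Q *m A).
  by rewrite !mulmxA QX -(mulmxA X Q Q) QQ.
have T : X *m Q *m A *m Q = X *m (Q *m A *m Q) by rewrite !mulmxA.
by rewrite mxtrace_mulC T offdiagonal_sandwich // mulmx0 linear0.
Qed.

Lemma trace_commutators A B : offdiagonal Q A -> offdiagonal Q B ->
  \tr ((A *m Q - Q *m A) *m (B *m Q - Q *m B)) = - \tr (A *m B).
Proof.
move=> hA hB; have zA := offdiagonal_sandwich hA; have zB := offdiagonal_sandwich hB.
have -> : (A *m Q - Q *m A) *m (B *m Q - Q *m B) = - (A *m Q *m B) - Q *m A *m B *m Q.
  rewrite mulmxBl !mulmxBr !mulmxA -(mulmxA A Q B) -(mulmxA A (Q *m B)) zB mulmx0.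
  by rewrite -(mulmxA A Q Q) QQ zA mul0mx subr0 sub0r mulmxA.
have tAB : \tr (A *m B) = \tr (Q *m A *m B) + \tr (A *m Q *m B).
  by rewrite -{1}hA mulmxDl linearD.
have t2 : \tr (Q *m A *m B *m Q) = \tr (Q *m A *m B).
  by rewrite mxtrace_mulC !mulmxA QQ.
by rewrite linearB linearN /= t2 tAB opprD addrC.
Qed.

Lemma trace_offdiagonal_mul A B : offdiagonal Q A ->
  \tr (A *m B) = \tr (Q *m A *m B) + \tr (Q *m B *m A).
Proof.
move=> hA; rewrite -{1}hA mulmxDl linearD; congr (_ + _).
by rewrite -mulmxA [LHS]mxtrace_mulC.
Qed.

Hypothesis trQ : \tr Q = 1.

(** Split the trace over the range and the kernel of Q.  Products of two of the
    matrices commute with Q, so on the range each pair acts by a scalar; the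
    kernel part is moved to the range by cycling the first factor. *)
Lemma trace_offdiagonal_mul4 A B C D : offdiagonal Q A -> offdiagonal Q B ->
  offdiagonal Q C -> offdiagonal Q D ->
  \tr (A *m B *m C *m D) = \tr (Q *m A *m B) * \tr (Q *m C *m D)
    + \tr (Q *m B *m C) * \tr (Q *m D *m A).
Proof.
move=> hA hB hC hD.
have key A' B' C' D' : offdiagonal Q A' -> offdiagonal Q B' ->
    offdiagonal Q C' -> offdiagonal Q D' ->
    \tr (Q *m A' *m B' *m C' *m D') = \tr (Q *m A' *m B') * \tr (Q *m C' *m D').
  move=> hA' hB' hC' hD'.
  have -> : Q *m A' *m B' *m C' *m D' = Q *m (A' *m B') *m Q *m (C' *m D').
    by rewrite (offdiagonal_mul_comm hA' hB') -(mulmxA _ Q Q) QQ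
      -(offdiagonal_mul_comm hA' hB') !mulmxA.
  by rewrite rank1_sandwich // -scalemxAl linearZ /= !mulmxA.
rewrite -{1}hA 3!mulmxDl linearD /= key //; congr (_ + _).
by rewrite -key // [RHS]mxtrace_mulC !mulmxA.
Qed.

Lemma trace_commutator_sq A B (l : K) : offdiagonal Q A -> offdiagonal Q B ->
  \tr (A *m A) = 2 * l -> \tr (B *m B) = 2 * l -> \tr (A *m B) = 0 ->
  \tr ((A *m B - B *m A) *m (A *m B - B *m A)) =
    6 * \tr (Q *m A *m B) ^+ 2 - 2 * l ^+ 2.
Proof.
move=> hA hB; rewrite !(trace_offdiagonal_mul _ hA) (trace_offdiagonal_mul _ hB).
move=> tA tB tAB; have n2 : (2 : K) != 0 by rewrite pnatr_eq0.
have {}tA : \tr (Q *m A *m A) = l by apply: (mulfI n2); rewrite -tA; ring.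
have {}tB : \tr (Q *m B *m B) = l by apply: (mulfI n2); rewrite -tB; ring.
have {}tAB : \tr (Q *m B *m A) = - \tr (Q *m A *m B).
  by apply/eqP; rewrite -subr_eq0 opprK addrC tAB.
rewrite mulmxBl !mulmxBr !linearB /= !mulmxA !trace_offdiagonal_mul4 //.
rewrite tA tB tAB; ring.
Qed.

End ProjectorAlgebra.

(** * Complex and matrix-valued functions *)

Section ComplexCalculus.
Variable R : realType.
Local Notation C := R[i].
Implicit Types (f g : R * R -> C) (x : R * R).

Lemma eq_ReIm (z w : C) :
  complex.Re z = complex.Re w -> complex.Im z = complex.Im w -> z = w.
Proof. by case: z w => [a b] [c d] /= -> ->. Qed.

Lemma Re_mul (z w : C) :
  complex.Re (z * w) = complex.Re z * complex.Re w - complex.Im z * complex.Im w.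
Proof. by case: z w => [a b] [c d]. Qed.

Lemma Im_mul (z w : C) :
  complex.Im (z * w) = complex.Re z * complex.Im w + complex.Im z * complex.Re w.
Proof. by case: z w => [a b] [c d]. Qed.

Lemma Re_add (z w : C) : complex.Re (z + w) = complex.Re z + complex.Re w.
Proof. by case: z w => [a b] [c d]. Qed.

Lemma Im_add (z w : C) : complex.Im (z + w) = complex.Im z + complex.Im w.
Proof. by case: z w => [a b] [c d]. Qed.

Lemma CkC_cst k (c : C) : CkC k (fun=> c).
Proof. by split; apply: Ck_cst. Qed.

Lemma CkCW k f : CkC k.+1 f -> CkC k f.
Proof. by move=> [Cr Ci]; split; apply: CkW. Qed.

Lemma CkC_pdC k f i : CkC k.+1 f -> CkC k (pdC i f).
Proof. by move=> [Cr Ci]; split; [apply: Ck_pdR Cr|apply: Ck_pdR Ci]. Qed.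

Lemma CkC_add k f g : CkC k f -> CkC k g -> CkC k (fun x => f x + g x).
Proof.
move=> [Cr Ci] [Cr' Ci']; split.
  by under eq_fun do rewrite Re_add; apply: Ck_add.
by under eq_fun do rewrite Im_add; apply: Ck_add.
Qed.

Lemma CkC_mul k f g : CkC k f -> CkC k g -> CkC k (fun x => f x * g x).
Proof.
move=> [Cr Ci] [Cr' Ci']; split.
  under eq_fun do rewrite Re_mul.
  exact: Ck_add (Ck_mul Cr Cr') (Ck_opp (Ck_mul Ci Ci')).
under eq_fun do rewrite Im_mul.
exact: Ck_add (Ck_mul Cr Ci') (Ck_mul Ci Cr').
Qed.

Lemma CkC_sum k (I : Type) (r : seq I) (h : I -> R * R -> C) :
  (forall j, CkC k (h j)) -> CkC k (fun x => \sum_(j <- r) h j x).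
Proof.
move=> Ch; elim: r => [|j r IH].
  by under eq_fun do rewrite big_nil; apply: CkC_cst.
by under eq_fun do rewrite big_cons; apply: CkC_add.
Qed.

Lemma pdC_cst i (c : C) x : pdC i (fun=> c) x = 0.
Proof. by rewrite /pdC /dirC !derive_cst. Qed.

Lemma pdC_add i f g x : CkC 1 f -> CkC 1 g ->
  pdC i (fun y => f y + g y) x = pdC i f x + pdC i g x.
Proof.
move=> [/Ck_differentiable dr /Ck_differentiable di].
move=> [/Ck_differentiable dr' /Ck_differentiable di'].
apply: eq_ReIm; rewrite ?Re_add ?Im_add /=.
  under eq_fun do rewrite Re_add.
  exact: (pdRD i (dr x) (dr' x)).
under eq_fun do rewrite Im_add.
exact: (pdRD i (di x) (di' x)).
Qed.

Lemma pdC_mul i f g x : CkC 1 f -> CkC 1 g ->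
  pdC i (fun y => f y * g y) x = pdC i f x * g x + f x * pdC i g x.
Proof.
move=> [/Ck_differentiable dr /Ck_differentiable di].
move=> [/Ck_differentiable dr' /Ck_differentiable di'].
have dN : differentiable ((\- (fun y => complex.Im (f y) * complex.Im (g y))) : _ -> R^o) x.
  by apply: differentiableN; apply: differentiableM.
apply: eq_ReIm; rewrite ?Re_add ?Im_add ?Re_mul ?Im_mul /=.
  under eq_fun do rewrite Re_mul.
  rewrite -[LHS]/(pdR i ((fun y => complex.Re (f y) * complex.Re (g y)) \+
    (\- (fun y => complex.Im (f y) * complex.Im (g y)))) x).
  rewrite pdRD //; last exact: differentiableM.
  rewrite pdRN; last exact: differentiableM.
  rewrite (pdRM i (dr x) (dr' x)) (pdRM i (di x) (di' x)) /pdR; ring.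
under eq_fun do rewrite Im_mul.
rewrite -[LHS]/(pdR i ((fun y => complex.Re (f y) * complex.Im (g y)) \+
    (fun y => complex.Im (f y) * complex.Re (g y))) x).
rewrite pdRD; [|exact: differentiableM..].
rewrite (pdRM i (dr x) (di' x)) (pdRM i (di x) (dr' x)) /pdR; ring.
Qed.

Lemma pdC_scale i (c : C) f x : CkC 1 f -> pdC i (fun y => c * f y) x = c * pdC i f x.
Proof. by move=> Cf; rewrite pdC_mul ?pdC_cst ?mul0r ?add0r //; apply: CkC_cst. Qed.

Lemma pdC_sum i (I : Type) (r : seq I) (h : I -> R * R -> C) x :
  (forall j, CkC 1 (h j)) ->
  pdC i (fun y => \sum_(j <- r) h j y) x = \sum_(j <- r) pdC i (h j) x.
Proof.
move=> Ch; elim: r => [|j r IH].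
  by under eq_fun do rewrite big_nil; rewrite pdC_cst big_nil.
under eq_fun do rewrite big_cons.
by rewrite pdC_add ?IH ?big_cons //; apply: CkC_sum.
Qed.

Lemma schwarzC i j f x : CkC 2 f -> pdC i (pdC j f) x = pdC j (pdC i f) x.
Proof. by move=> [Cr Ci]; apply: eq_ReIm => /=; apply: schwarz. Qed.

Lemma dpC_dmC f x : CkC 2 f ->
  dpC (dmC f) x = 4^-1 * (pdC 0 (pdC 0 f) x + pdC 1 (pdC 1 f) x).
Proof.
move=> Cf; have C1 i := CkC_pdC i Cf.
rewrite /dpC.
have -> : dmC f = fun y => 2^-1 * (pdC 0 f y + 'i%C * pdC 1 f y) by [].
have Ci : CkC 1 (fun y => 'i%C * pdC 1 f y) by apply: CkC_mul => //; apply: CkC_cst.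
have Ca : CkC 1 (fun y => pdC 0 f y + 'i%C * pdC 1 f y) by apply: CkC_add.
rewrite !(pdC_scale _ _ _ Ca) !(pdC_add _ _ (C1 0) Ci) !(pdC_scale _ _ _ (C1 1)).
rewrite (schwarzC 1 0 x Cf).
set u := pdC 0 (pdC 0 f) x; set v := pdC 0 (pdC 1 f) x; set w := pdC 1 (pdC 1 f) x.
have ii : 'i%C * 'i%C = -1 :> C by rewrite -expr2 sqr_i.
have -> : 2^-1 * (2^-1 * (u + 'i%C * v) - 'i%C * (2^-1 * (v + 'i%C * w))) =
  4^-1 * (u - ('i%C * 'i%C) * w) :> C by field.
by rewrite ii mulN1r opprK.
Qed.

End ComplexCalculus.

Section MatrixCalculus.
Variables (R : realType) (N : nat).
Local Notation C := R[i].
Local Notation M := 'M[C]_N.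
Implicit Types (A B : R * R -> M) (x : R * R).

Lemma CkM_W k A : CkM k.+1 A -> CkM k A.
Proof. by move=> CA j l; apply: CkCW. Qed.

Lemma pdM_entry i A x j k : pdM i A x j k = pdC i (fun y => A y j k) x.
Proof. by rewrite /pdM /entrywise mxE. Qed.

Lemma dpM_entry A x j k : dpM A x j k = dpC (fun y => A y j k) x.
Proof. by rewrite /dpM /entrywise mxE. Qed.

Lemma dmM_entry A x j k : dmM A x j k = dmC (fun y => A y j k) x.
Proof. by rewrite /dmM /entrywise mxE. Qed.

Lemma CkM_pdM k i A : CkM k.+1 A -> CkM k (pdM i A).
Proof. by move=> CA j l; under eq_fun do rewrite pdM_entry; apply: CkC_pdC. Qed.

Lemma CkM_differentiable k A : CkM k.+1 A -> Defs.differentiableM A.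
Proof.
by move=> CA j l x; have [Cr Ci] := CA j l; split; apply: Ck_differentiable; eassumption.
Qed.

Lemma CkM_mul k A B : CkM k A -> CkM k B -> CkM k (fun x => A x *m B x).
Proof.
move=> CA CB j l; under eq_fun do rewrite mxE.
by apply: CkC_sum => m; apply: CkC_mul.
Qed.

Lemma CkM_add k A B : CkM k A -> CkM k B -> CkM k (fun x => A x + B x).
Proof.
by move=> CA CB j l; under eq_fun do rewrite mxE; apply: CkC_add.
Qed.

Lemma CkM_scale k c A : CkM k A -> CkM k (fun x => c *: A x).
Proof.
by move=> CA j l; under eq_fun do rewrite mxE; apply: CkC_mul => //; apply: CkC_cst.
Qed.

Lemma pdM_add i A B x : CkM 1 A -> CkM 1 B ->
  pdM i (fun y => A y + B y) x = pdM i A x + pdM i B x.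
Proof.
move=> CA CB; apply/matrixP => j l; rewrite !mxE.
by under eq_fun do rewrite mxE; rewrite pdC_add.
Qed.

Lemma pdM_scale i c A x : CkM 1 A -> pdM i (fun y => c *: A y) x = c *: pdM i A x.
Proof.
move=> CA; apply/matrixP => j l; rewrite !mxE.
by under eq_fun do rewrite mxE; rewrite pdC_scale.
Qed.

Lemma pdM_mul i A B x : CkM 1 A -> CkM 1 B ->
  pdM i (fun y => A y *m B y) x = pdM i A x *m B x + A x *m pdM i B x.
Proof.
move=> CA CB; apply/matrixP => j l; rewrite !mxE.
under eq_fun do rewrite mxE.
rewrite pdC_sum; last by move=> m; apply: CkC_mul.
rewrite -big_split; apply: eq_bigr => m _; rewrite !mxE.
exact: pdC_mul.
Qed.

Lemma schwarzM i j A x : CkM 2 A -> pdM i (pdM j A) x = pdM j (pdM i A) x.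
Proof.
move=> CA; apply/matrixP => k l; rewrite [LHS]pdM_entry [RHS]pdM_entry.
have E j' : (fun y => pdM j' A y k l) = pdC j' (fun y => A y k l).
  by apply/funext => y; rewrite pdM_entry.
rewrite !E; exact: schwarzC (CA k l).
Qed.

Lemma dpME A x : dpM A x = 2^-1 *: (pdM 0 A x - 'i%C *: pdM 1 A x).
Proof.
apply/matrixP => j l; rewrite dpM_entry [RHS]mxE; congr (_ * _).
rewrite [RHS]mxE pdM_entry; congr (_ + _).
by rewrite [RHS]mxE; congr (- _); rewrite [RHS]mxE pdM_entry.
Qed.

Lemma dmME A x : dmM A x = 2^-1 *: (pdM 0 A x + 'i%C *: pdM 1 A x).
Proof.
apply/matrixP => j l; rewrite dmM_entry [RHS]mxE; congr (_ * _).
rewrite [RHS]mxE pdM_entry; congr (_ + _).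
by rewrite [RHS]mxE pdM_entry.
Qed.

Lemma dpM_dmM A x : CkM 2 A ->
  dpM (dmM A) x = 4^-1 *: (pdM 0 (pdM 0 A) x + pdM 1 (pdM 1 A) x).
Proof.
move=> CA; apply/matrixP => j l; rewrite dpM_entry.
have -> : (fun y => dmM A y j l) = dmC (fun y => A y j l).
  by apply/funext => y; rewrite dmM_entry.
have E i : (fun y => pdM i A y j l) = pdC i (fun y => A y j l).
  by apply/funext => y; rewrite pdM_entry.
rewrite (dpC_dmC x (CA j l)) [RHS]mxE; congr (_ * _).
by rewrite [RHS]mxE; congr (_ + _); rewrite [RHS]pdM_entry E.
Qed.

(** This is -2 times [inner], normalized so that it is positive definite on
    Hermitian matrices. *)
Definition rdot (A B : M) : R := complex.Re (\tr (A *m B)).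

Lemma rdotC (A B : M) : rdot A B = rdot B A.
Proof. by rewrite /rdot mxtrace_mulC. Qed.

Lemma rdotDl (A B D : M) : rdot (A + B) D = rdot A D + rdot B D.
Proof. by rewrite /rdot mulmxDl mxtraceD Re_add. Qed.

Lemma rdotE (A B : M) : rdot A B = \sum_j \sum_k
  (complex.Re (A j k) * complex.Re (B k j) - complex.Im (A j k) * complex.Im (B k j)).
Proof.
have Re_sum (f : 'I_N -> C) : complex.Re (\sum_j f j) = \sum_j complex.Re (f j).
  exact: (big_morph (@complex.Re R) (@Re_add R) erefl).
rewrite /rdot /mxtrace Re_sum; apply: eq_bigr => j _.
by rewrite mxE Re_sum; apply: eq_bigr => k _; rewrite Re_mul.
Qed.

Lemma CkC_trace k A : CkM k A -> CkC k (fun x => \tr (A x)).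
Proof. by move=> CA; apply: CkC_sum. Qed.

Lemma Ck_rdot k A B : CkM k A -> CkM k B -> Ck k (fun x => rdot (A x) (B x)).
Proof. by move=> CA CB; have [] := CkC_trace (CkM_mul CA CB). Qed.

Lemma pdR_rdot i A B x : CkM 1 A -> CkM 1 B ->
  pdR i (fun y => rdot (A y) (B y)) x = rdot (pdM i A x) (B x) + rdot (A x) (pdM i B x).
Proof.
move=> CA CB; have CAB := CkM_mul CA CB.
have E : pdC i (fun y => \tr (A y *m B y)) x = \tr (pdM i A x *m B x + A x *m pdM i B x).
  rewrite -pdM_mul // /mxtrace pdC_sum //.
  by apply: eq_bigr => j _; rewrite mxE.
rewrite -[LHS]/(complex.Re (pdC i (fun y => \tr (A y *m B y)) x)) E.
by rewrite mxtraceD Re_add.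
Qed.

Lemma vanishes_rdot A B :
  (forall j k, vanishes_at_infinity (fun x => complex.Re (A x j k)) /\
     vanishes_at_infinity (fun x => complex.Im (A x j k))) ->
  (forall j k, vanishes_at_infinity (fun x => complex.Re (B x j k)) /\
     vanishes_at_infinity (fun x => complex.Im (B x j k))) ->
  vanishes_at_infinity (fun x => rdot (A x) (B x)).
Proof.
move=> vA vB; under eq_fun do rewrite rdotE.
apply: vanishes_sum => j; apply: vanishes_sum => k.
have [Ar Ai] := vA j k; have [Br Bi] := vB k j.
apply: vanishes_add; first exact: vanishes_mul.
exact: vanishesN (vanishes_mul Ai Bi).
Qed.

End MatrixCalculus.

(** * Curvature of a conformal metric *)

Section ConformalMetric.
Variables (R : realType) (L : R * R -> R).
Implicit Types (x y : R * R).
Hypothesis CL : Ck 2 L.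

Lemma sum_delta (V : lmodType R) (a : R) (f : 'I_2 -> V) (i : 'I_2) :
  \sum_j ((a%:M : 'M[R]_2) i j) *: f j = a *: f i.
Proof.
rewrite (bigD1 i) //= mxE eqxx mulr1n big1 ?addr0 // => j ji.
by rewrite mxE eq_sym (negPf ji) mulr0n scale0r.
Qed.

Lemma sum_ord2 (V : nmodType) (f : 'I_2 -> V) : \sum_j f j = f 0 + f 1.
Proof. by rewrite big_ord_recl big_ord1; congr (_ + f _); apply: val_inj. Qed.

Lemma pdR_scalar i j k y :
  pdR i (fun y => (L y)%:M j k) y = pdR i L y *+ (j == k :> 'I_2).
Proof.
have -> : (fun y => (L y)%:M j k) = fun y => L y *+ (j == k).
  by apply/funext => z; rewrite mxE.
by case: (j == k); rewrite ?mulr1n ?mulr0n ?pdR_cst.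
Qed.

Definition logder i y := (L y)^-1 * pdR i L y.

Lemma christoffel_conformal k i j y :
  christoffel (fun y => (L y)%:M) k i j y =
  2^-1 * (logder i y *+ (j == k) + logder j y *+ (i == k) - logder k y *+ (i == j)).
Proof.
rewrite /christoffel invmx_scalar; congr (_ * _).
rewrite (sum_delta (V := R^o)) !pdR_scalar /logder.
rewrite /GRing.scale /= mulrBr mulrDr !mulrnAr (eq_sym j k) (eq_sym i k).
by rewrite (eq_sym k j) (eq_sym k i).
Qed.

Lemma logder_differentiable i x : L x != 0 -> differentiable (logder i : _ -> R^o) x.
Proof.
move=> L0; apply: differentiableM.
  by apply: differentiableV => //; apply: (Ck_differentiable CL).
exact: (Ck_differentiable (Ck_pdR i CL)).
Qed.

(** The quadratic terms in the Christoffel symbols cancel, which leaves the two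
    derivatives of the logarithmic derivatives of the conformal factor. *)
Lemma gauss_curvature_conformal x : L x != 0 ->
  gauss_curvature_metric (fun y => (L y)%:M) x =
  - (pdR 0 (logder 0) x + pdR 1 (logder 1) x) / (2 * L x).
Proof.
move=> L0; rewrite /gauss_curvature_metric det_scalar.
rewrite (sum_delta (L x) (fun l => riemann _ l 1 0 1 x : R^o)) /riemann.
have e01 : ((0 : 'I_2) == 1) = false by [].
have e10 : ((1 : 'I_2) == 0) = false by [].
have e00 : ((0 : 'I_2) == 0) = true by [].
have e11 : ((1 : 'I_2) == 1) = true by [].
pose eqs := (e00, e11, e01, e10).
have E011 : christoffel (fun y => (L y)%:M) 0 1 1 = fun y => - 2^-1 * logder 0 y.
  apply/funext => y; rewrite christoffel_conformal !eqs !(mulr1n, mulr0n).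
  by move: (logder 0 y) (logder 1 y) => a b; ring.
have E001 : christoffel (fun y => (L y)%:M) 0 0 1 = fun y => 2^-1 * logder 1 y.
  apply/funext => y; rewrite christoffel_conformal !eqs !(mulr1n, mulr0n).
  by move: (logder 0 y) (logder 1 y) => a b; ring.
have -> : \sum_m (christoffel (fun y => (L y)%:M) m 1 1 x *
      christoffel (fun y => (L y)%:M) 0 0 m x -
    christoffel (fun y => (L y)%:M) m 0 1 x *
      christoffel (fun y => (L y)%:M) 0 1 m x) = 0.
  rewrite (sum_ord2 (V := R)).
  rewrite !christoffel_conformal.
  move: (logder 0 x) (logder 1 x) => a b.
  by rewrite !eqs !(mulr1n, mulr0n); ring.
rewrite E011 E001 !pdR_scale; [|exact: logder_differentiable..].
move: (pdR 0 _ x) (pdR 1 _ x) (L x) L0 => a b l l0.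
rewrite /GRing.scale /= expr2.
field; exact: l0.
Qed.

Lemma near_gt0 x : 0 < L x ->
  \forall y \near x, 0 < L y.
Proof.
move=> L0; have [d d0 Hd] := continuous_near x (Ck_continuous CL) L0.
apply: (near_norm d0) => y /Hd; rewrite ltr_norml ltrBlDr ltrDl.
by move=> /andP[].
Qed.

Lemma pdR_ln i y : 0 < L y -> pdR i (fun y => ln (L y)) y = logder i y.
Proof.
move=> L0; have dL := Ck_differentiable CL y.
have [dln Eln] := is_derive1_ln L0.
have dln' : differentiable (@ln R : R -> R^o) (L y) by apply/derivable1_diffP.
rewrite /pdR deriveE; last exact: (differentiable_comp dL dln').
rewrite (diff_comp dL dln') /= (@deriv1E _ R^o (@ln R)) // derive1E Eln.
by rewrite /logder /pdR deriveE // [LHS]mulrC.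
Qed.

Lemma pdR_logder_sym i j x : L x != 0 -> pdR i (logder j) x = pdR j (logder i) x.
Proof.
move=> L0.
have dL := Ck_differentiable CL x.
have dV : differentiable ((fun y => (L y)^-1) : _ -> R^o) x by apply: differentiableV.
rewrite (pdRM i dV (Ck_differentiable (Ck_pdR j CL) x)).
rewrite (pdRM j dV (Ck_differentiable (Ck_pdR i CL) x)).
rewrite !(pdRV _ dL L0) (schwarz i j x CL).
by move: (pdR i L x) (pdR j L x) (pdR j (pdR i L) x) (L x) => *; ring.
Qed.

Lemma dmC_real (h : R * R -> R) y :
  dmC (fun z => (h z)%:C) y = (2^-1 * pdR 0 h y) +i* (2^-1 * pdR 1 h y).
Proof.
have H : (2%:R^-1 : R[i]) = (2^-1)%:C by rewrite fmorphV rmorph_nat.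
have E i : pdC i (fun z => (h z)%:C) y = (pdR i h y)%:C.
  by apply: eq_ReIm => //=; apply: derive_cst.
by rewrite /dmC !E H; apply: eq_ReIm; rewrite /=; ring.
Qed.

(** The conformal factor may vanish away from [x], so its logarithm is replaced
    near [x] by the logarithmic derivatives, which are defined everywhere; their
    cross derivatives agree and the imaginary part cancels. *)
Lemma dpC_dmC_ln x : 0 < L x ->
  dpC (dmC (fun y => (ln (L y))%:C)) x =
  (4^-1 * (pdR 0 (logder 0) x + pdR 1 (logder 1) x))%:C.
Proof.
move=> L0; have Ln0 : L x != 0 by rewrite gt_eqF.
set h := fun y => ln (L y).
have -> : dmC (fun y => (ln (L y))%:C) =
    fun y => (2^-1 * pdR 0 h y) +i* (2^-1 * pdR 1 h y).
  by apply/funext => y; rewrite -dmC_real.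
have half i j : 'D_(evec R i) (fun y => 2^-1 * pdR j h y : R^o) x =
    2^-1 * pdR i (logder j) x.
  rewrite -pdR_scale; last exact: logder_differentiable.
  apply: near_eq_derive; near=> y; rewrite pdR_ln //; near: y.
  exact: near_gt0.
have H : (2%:R^-1 : R[i]) = (2^-1)%:C by rewrite fmorphV rmorph_nat.
have E i : pdC i (fun y => (2^-1 * pdR 0 h y) +i* (2^-1 * pdR 1 h y)) x =
    (2^-1 * pdR i (logder 0) x) +i* (2^-1 * pdR i (logder 1) x).
  by apply: eq_ReIm; [exact: (half i 0)|exact: (half i 1)].
rewrite /dpC !E H (pdR_logder_sym 1 0 Ln0).
move: (pdR 0 (logder 0) x) (pdR 1 (logder 1) x) (pdR 0 (logder 1) x) => a b c.
by apply: eq_ReIm; rewrite /=; field.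
Unshelve. all: by end_near.
Qed.

End ConformalMetric.

(** * Vanishing of the Hopf differential *)

Local Opaque pdR pdC pdM dpM dmM.

Section HopfDifferential.
(* A and B stand for the two partial derivatives of a map whose Laplacian is
   orthogonal to its partial derivatives; a and - 2 b are the real and imaginary
   parts of its Hopf differential. *)
Variables (R : realType) (N : nat) (A B : R * R -> 'M[R[i]]_N).
Hypotheses (CA : CkM 2 A) (CB : CkM 2 B).
Hypothesis closedAB : forall x, pdM 1 A x = pdM 0 B x.
Hypothesis orthA : forall x, rdot (pdM 0 A x + pdM 1 B x) (A x) = 0.
Hypothesis orthB : forall x, rdot (pdM 0 A x + pdM 1 B x) (B x) = 0.

Let a x := rdot (A x) (A x) - rdot (B x) (B x).
Let b x := rdot (A x) (B x).

Let Ca : Ck 2 a.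
Proof. exact: Ck_add (Ck_rdot CA CA) (Ck_opp (Ck_rdot CB CB)). Qed.

Let Cb : Ck 2 b.
Proof. exact: Ck_rdot CA CB. Qed.

Let pd_a i x : pdR i a x =
  2 * (rdot (pdM i A x) (A x) - rdot (pdM i B x) (B x)).
Proof.
have CA1 := CkM_W CA; have CB1 := CkM_W CB.
have C0 := Ck_differentiable (Ck_rdot CA1 CA1) x.
have C1 := Ck_differentiable (Ck_rdot CB1 CB1) x.
rewrite (pdRD i C0 (differentiableN C1)) (pdRN i C1).
rewrite (pdR_rdot i x CA1 CA1) (pdR_rdot i x CB1 CB1).
rewrite (rdotC (A x)) (rdotC (B x)).
by set u := rdot _ (A x); set v := rdot _ (B x); ring.
Qed.

Let pd_b i x : pdR i b x =
  rdot (pdM i A x) (B x) + rdot (pdM i B x) (A x).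
Proof. by rewrite (pdR_rdot i x (CkM_W CA) (CkM_W CB)) (rdotC (A x)). Qed.

(* The next two identities are the Cauchy-Riemann equations of a - 2 i b. *)
Let cr1 : pdR 0 a = fun x => - 2 * pdR 1 b x.
Proof.
have key (u v w : R) : u + v = 0 -> 2 * (u - w) = - 2 * (w + v).
  by move=> /eqP; rewrite addr_eq0 => /eqP ->; ring.
apply/funext => x; rewrite pd_a pd_b closedAB; apply: key.
by rewrite -rdotDl.
Qed.

Let cr2 : pdR 1 a = fun x => 2 * pdR 0 b x.
Proof.
have key (u v w : R) : u + v = 0 -> 2 * (w - v) = 2 * (u + w).
  by move=> /eqP; rewrite addr_eq0 => /eqP ->; ring.
apply/funext => x; rewrite pd_a pd_b closedAB; apply: key.
by rewrite -rdotDl.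
Qed.

Let cr (f : R * R -> R) (c : R) i x : Ck 1 f ->
  pdR i (fun y => c * f y) x = c * pdR i f x.
Proof. by move=> Cf; apply: pdR_scale; apply: Ck_differentiable Cf x. Qed.

Lemma hopf_harmonic_re x : pdR 0 (pdR 0 a) x + pdR 1 (pdR 1 a) x = 0.
Proof.
rewrite cr1 cr2 (cr _ _ _ (Ck_pdR 1 Cb)) (cr _ _ _ (Ck_pdR 0 Cb)).
by rewrite (schwarz 1 0 x Cb) -mulrDl addNr mul0r.
Qed.

Lemma hopf_harmonic_im x : pdR 0 (pdR 0 b) x + pdR 1 (pdR 1 b) x = 0.
Proof.
have n2 : (2 : R) != 0 by rewrite pnatr_eq0.
have d0 : pdR 0 b = fun z => 2^-1 * pdR 1 a z.
  by apply/funext => z; rewrite cr2 mulKf.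
have d1 : pdR 1 b = fun z => - 2^-1 * pdR 0 a z.
  by apply/funext => z; rewrite cr1 mulrA mulrNN mulVf ?mul1r.
rewrite d0 d1 (cr _ _ _ (Ck_pdR 1 Ca)) (cr _ _ _ (Ck_pdR 0 Ca)).
by rewrite (schwarz 1 0 x Ca) -mulrDl addrN mul0r.
Qed.

Hypothesis vanA : forall j k,
  vanishes_at_infinity (fun x => complex.Re (A x j k)) /\
  vanishes_at_infinity (fun x => complex.Im (A x j k)).
Hypothesis vanB : forall j k,
  vanishes_at_infinity (fun x => complex.Re (B x j k)) /\
  vanishes_at_infinity (fun x => complex.Im (B x j k)).

Lemma hopf_differential_eq0 x :
  rdot (A x) (A x) = rdot (B x) (B x) /\ rdot (A x) (B x) = 0.
Proof.
have va : vanishes_at_infinity a.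
  apply: vanishes_add; first exact: vanishes_rdot.
  by apply: vanishesN; apply: vanishes_rdot.
have vb : vanishes_at_infinity b by apply: vanishes_rdot.
split; last exact: harmonic_vanishing_eq0 Cb hopf_harmonic_im vb x.
apply/eqP; rewrite -subr_eq0; apply/eqP.
exact: (harmonic_vanishing_eq0 Ca hopf_harmonic_re va x).
Qed.

End HopfDifferential.

(** * Projector fields solving the Euler-Lagrange equation *)

Section ProjectorField.
Variables (R : realType) (N : nat).
Local Notation C := R[i].
Local Notation M := 'M[C]_N.
Variable p : R * R -> M.
Hypothesis Cp : CkM 3 p.
Hypothesis projp : forall x, rank1_projector (p x).
Implicit Types (x : R * R).

Local Notation "'P1'" := (pdM 0 p).
Local Notation "'P2'" := (pdM 1 p).

Let Cp2 : CkM 2 p := CkM_W Cp.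
Let Cp1 : CkM 1 p := CkM_W Cp2.
Let CP2 i : CkM 2 (pdM i p) := CkM_pdM i Cp.
Let CP1 i : CkM 1 (pdM i p) := CkM_W (CP2 i).

Lemma projector_mul x : p x *m p x = p x. Proof. by have [] := projp x. Qed.
Lemma projector_tr x : \tr (p x) = 1. Proof. by have [] := projp x. Qed.
Lemma projector_herm x : (p x) ^t* = p x. Proof. by have [] := projp x. Qed.

Lemma pdM_offdiagonal i x : offdiagonal (p x) (pdM i p x).
Proof.
have := pdM_mul i x Cp1 Cp1.
have -> : (fun y => p y *m p y) = p by apply/funext => y; apply: projector_mul.
by move=> E; rewrite /offdiagonal [RHS]E addrC.
Qed.

(** P1 and P2 are recovered from the complex derivatives, which the adjoint
    exchanges. *)
Lemma pdM_herm i x : (pdM i p x) ^t* = pdM i p x.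
Proof.
have dp := CkM_differentiable Cp1.
have hp := adjoint_dpM projector_herm dp x.
have hm := adjoint_dmM projector_herm dp x.
have E0 : P1 x = dpM p x + dmM p x.
  rewrite dpME dmME; move: (P1 x) (P2 x) => A B.
  by apply/matrixP => j k; rewrite !mxE; field.
have E1 : P2 x = 'i%C *: (dpM p x - dmM p x).
  rewrite dpME dmME; move: (P1 x) (P2 x) => A B.
  apply/matrixP => j k; rewrite !mxE; transitivity (- 'i%C ^+ 2 * B j k); last by field.
  by rewrite sqr_i opprK mul1r.
have i01 : i = 0 \/ i = 1.
  by case: i => [[|[|//]] hi]; [left|right]; apply: val_inj.
case: i01 => ->.
  by rewrite E0 linearD map_mxD hp hm addrC.
rewrite E1 linearZ linearB /= map_mxZ map_mxB hp hm -opprB scalerN -scaleNr.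
by congr (_ *: _); apply: eq_ReIm; rewrite /= ?opprK ?oppr0.
Qed.

Lemma trace_real i j x :
  \tr (pdM i p x *m pdM j p x) = (rdot (pdM i p x) (pdM j p x))%:C.
Proof.
move: (pdM i p x) (pdM j p x) (pdM_herm i x) (pdM_herm j x) => A B hA hB.
rewrite /rdot conjc_fix_Re; first by [].
by rewrite -mxtrace_adjoint adjointM hA hB mxtrace_mulC.
Qed.

Lemma euler_lagrange_comm x : euler_lagrange p ->
  p x *m (pdM 0 P1 x + pdM 1 P2 x) = (pdM 0 P1 x + pdM 1 P2 x) *m p x.
Proof.
move=> /(_ x); rewrite (dpM_dmM x Cp2) /commutator -scalemxAl -scalemxAr -scalerBr.
move/eqP; rewrite scaler_eq0 invr_eq0 pnatr_eq0 /= subr_eq0 => /eqP E.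
exact/esym.
Qed.

Hypothesis ELp : euler_lagrange p.

(** The Laplacian preserves the range and the kernel of the projector, while the
    derivatives exchange them. *)
Lemma laplacian_orth i x : rdot (pdM 0 P1 x + pdM 1 P2 x) (pdM i p x) = 0.
Proof.
rewrite /rdot (trace_comm_offdiagonal (projector_mul x)); first by [].
  exact: euler_lagrange_comm.
exact: pdM_offdiagonal.
Qed.

End ProjectorField.

(** * Geometry of the associated surface *)

Section Surface.
Variables (R : realType) (N : nat).
Local Notation C := R[i].
Local Notation M := 'M[C]_N.

Lemma innerE_rdot (X Y : M) : inner X Y = - 2^-1 * rdot X Y.
Proof.
have H : (2%:R^-1 : C) = (2^-1)%:C by rewrite fmorphV rmorph_nat.
rewrite /inner /rdot H; case: (\tr _) => u v /=; ring.
Qed.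

Lemma innerDl (X Y Z : M) : inner (X + Y) Z = inner X Z + inner Y Z.
Proof. by rewrite !innerE_rdot rdotDl mulrDr. Qed.

Lemma sum_scalar_mx (V : lmodType C) (a : R) (f : 'I_2 -> V) (i : 'I_2) :
  \sum_j (((a%:M : 'M[R]_2) i j)%:C) *: f j = a%:C *: f i.
Proof.
rewrite (bigD1 i) //= mxE eqxx mulr1n big1 ?addr0 // => j ji.
by rewrite mxE eq_sym (negPf ji) mulr0n scale0r.
Qed.

(** For an isothermal immersion the mean curvature vector is the Laplacian over
    the conformal factor, once the Laplacian is known to be normal. *)
Lemma mean_curvature_conformal (F : R * R -> M) (L : R * R -> R) x :
  fundform1 F = (fun y => (L y)%:M) ->
  (forall i, inner (pdM 0 (pdM 0 F) x + pdM 1 (pdM 1 F) x) (pdM i F x) = 0) ->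
  mean_curvature F x = ((L x)^-1)%:C *: (pdM 0 (pdM 0 F) x + pdM 1 (pdM 1 F) x).
Proof.
move=> gE; rewrite /mean_curvature /fundform2 gE invmx_scalar => orth.
under eq_bigr do rewrite sum_scalar_mx.
rewrite -scaler_sumr sum_ord2 addrACA -opprD -big_split /=.
rewrite [X in _ - X]big1 ?subr0 // => k _.
rewrite -big_split /= big1 // => l _.
by rewrite -scalerDl -rmorphD /= -mulrDr -innerDl orth mulr0 scale0r.
Qed.

Variable p : R * R -> M.
Hypothesis Cp : CkM 3 p.
Hypothesis projp : forall x, rank1_projector (p x).
Implicit Types (x : R * R).

Local Notation "'P1'" := (pdM 0 p).
Local Notation "'P2'" := (pdM 1 p).

Let Cp2 : CkM 2 p := CkM_W Cp.
Let Cp1 : CkM 1 p := CkM_W Cp2.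
Let CP1 i : CkM 1 (pdM i p) := CkM_W (CkM_pdM i Cp).

Lemma commutatorC (X Y : M) : commutator X Y = - commutator Y X.
Proof. by rewrite /commutator opprB. Qed.

Lemma dp_dm_commutator x :
  commutator (dpM p x) (dmM p x) = (2^-1 * 'i%C) *: commutator (P1 x) (P2 x).
Proof.
rewrite dpME dmME; move: (P1 x) (P2 x) => A B; rewrite /commutator.
rewrite -!scalemxAl -!scalemxAr !mulmxBl !mulmxBr !mulmxDl !mulmxDr.
rewrite -!scalemxAl -!scalemxAr.
move: (A *m A) (A *m B) (B *m A) (B *m B) => aa ab ba bb.
by apply/matrixP => j k; rewrite !mxE; field.
Qed.

Lemma commutator_lin (c : C) (X Y Z : M) :
  commutator (X + c *: Y) Z = commutator X Z + c *: commutator Y Z.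
Proof.
rewrite /commutator mulmxDl mulmxDr -scalemxAl -scalemxAr scalerBr.
by rewrite opprD addrACA.
Qed.

Lemma commutatorZ (c : C) (X Y : M) : commutator (c *: X) Y = c *: commutator X Y.
Proof. by rewrite /commutator -scalemxAl -scalemxAr scalerBr. Qed.

Lemma surface_partials F : associated_surface p F ->
  pdM 0 F = (fun x => - commutator (P2 x) (p x)) /\
  pdM 1 F = (fun x => commutator (P1 x) (p x)).
Proof.
move=> [_ _ dF].
have dE x v : dirM v F x = 'i%C *: (2^-1 *:
    ((xim v - xip v) *: commutator (P1 x) (p x) +
     ((xim v + xip v) * 'i%C) *: commutator (P2 x) (p x))).
  rewrite dF dpME dmME -scaleNr !commutatorZ -scaleNr !commutator_lin.
  move: (commutator (P1 x) _) (commutator (P2 x) _) (xip v) (xim v) => a b u w.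
  move: 'i%C => I; congr (_ *: _); apply/matrixP => j k; rewrite !mxE.
  by move: (a j k) (b j k) => s t; field.
have i2 : 'i%C * 'i%C = -1 :> C by rewrite -expr2 sqr_i.
have n2 : (2 : C) != 0 by rewrite pnatr_eq0.
split; apply/funext => x.
  have [E1 E2] : xim (evec R 0) - xip (evec R 0) = 0 /\
      xim (evec R 0) + xip (evec R 0) = 2.
    by split; apply: eq_ReIm; rewrite /= ?oppr0 ?subrr ?addr0 //.
  rewrite -[LHS]/(dirM (evec R 0) F x) dE E1 E2 scale0r add0r !scalerA.
  by rewrite -mulrA mulKf // i2 scaleN1r.
have [E1 E2] : xim (evec R 1) - xip (evec R 1) = - 2 * 'i%C /\
    xim (evec R 1) + xip (evec R 1) = 0.
  by split; apply: eq_ReIm; rewrite /=; ring.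
rewrite -[LHS]/(dirM (evec R 1) F x) dE E1 E2 mul0r scale0r addr0 !scalerA.
by rewrite mulNr mulrN -mulrA mulKf // i2 opprK scale1r.
Qed.

Lemma pdM_commutator i (X Y : R * R -> M) x : CkM 1 X -> CkM 1 Y ->
  pdM i (fun y => commutator (X y) (Y y)) x =
  commutator (pdM i X x) (Y x) + commutator (X x) (pdM i Y x).
Proof.
move=> CX CY; have CXY := CkM_mul CX CY; have CYX := CkM_mul CY CX.
have -> : (fun y => commutator (X y) (Y y)) =
    fun y => X y *m Y y + (-1) *: (Y y *m X y).
  by apply/funext => y; rewrite scaleN1r.
rewrite (pdM_add i x CXY (CkM_scale (-1) CYX)) (pdM_scale i (-1) x CYX).
rewrite !pdM_mul // scaleN1r opprD /commutator.
by rewrite [- _ - _]addrC addrACA.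
Qed.

Lemma CkM_commutator k (X Y : R * R -> M) : CkM k X -> CkM k Y ->
  CkM k (fun y => commutator (X y) (Y y)).
Proof.
move=> CX CY.
have -> : (fun y => commutator (X y) (Y y)) =
    fun y => X y *m Y y + (-1) *: (Y y *m X y).
  by apply/funext => y; rewrite scaleN1r.
by apply: CkM_add; [exact: CkM_mul|apply: CkM_scale; exact: CkM_mul].
Qed.

Lemma surface_laplacian F x : associated_surface p F ->
  pdM 0 (pdM 0 F) x + pdM 1 (pdM 1 F) x = 2 *: commutator (P1 x) (P2 x).
Proof.
move=> /surface_partials[-> ->].
have -> : (fun y => - commutator (P2 y) (p y)) =
    (fun y => (-1) *: commutator (P2 y) (p y)).
  by apply/funext => y; rewrite scaleN1r.
rewrite (pdM_scale 0 (-1) x (CkM_commutator (CP1 1) Cp1)).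
rewrite (pdM_commutator 0 x (CP1 1) Cp1) (pdM_commutator 1 x (CP1 0) Cp1).
rewrite (schwarzM 1 0 x Cp2) scaleN1r (commutatorC (P2 x)).
move: (commutator (pdM 0 _ x) _) (commutator (P1 x) _) => u v.
by rewrite opprB addrA subrK scaler_nat mulr2n.
Qed.

Lemma inner_commutators i j x :
  inner (commutator (pdM i p x) (p x)) (commutator (pdM j p x) (p x)) =
  2^-1 * rdot (pdM i p x) (pdM j p x).
Proof.
rewrite innerE_rdot /rdot /commutator.
rewrite (trace_commutators (projector_mul projp x)); try exact: pdM_offdiagonal.
by case: (\tr _) => u v /=; rewrite mulrNN.
Qed.

Lemma inner_commutator_tangent i x :
  inner (commutator (P1 x) (P2 x)) (commutator (pdM i p x) (p x)) = 0.
Proof.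
rewrite innerE_rdot /rdot trace_comm_commutator ?mulr0 //.
by apply: commutator_comm; apply: pdM_offdiagonal.
Qed.

Lemma lagrangian_real x :
  lagrangian p x = 4^-1 * (rdot (P1 x) (P1 x) + rdot (P2 x) (P2 x)).
Proof.
have H : (4%:R^-1 : C) = (4^-1)%:C by rewrite fmorphV rmorph_nat.
have E : \tr (dpM p x *m dmM p x) =
    (4^-1)%:C * (\tr (P1 x *m P1 x) + \tr (P2 x *m P2 x)).
  rewrite -H dpME dmME; move: (P1 x) (P2 x) => A B.
  rewrite -!scalemxAl -!scalemxAr !mulmxBl !mulmxDr -!scalemxAl -!scalemxAr.
  rewrite !(mxtraceZ, mxtraceD, raddfN) /= !(mxtraceZ, mxtraceD) (mxtrace_mulC B A).
  move: (\tr (A *m A)) (\tr (A *m B)) (\tr (B *m B)) => u v w.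
  transitivity (4^-1 * (u - 'i%C ^+ 2 * w)); first by field.
  by rewrite sqr_i mulN1r opprK.
by rewrite /lagrangian E Re_mul Re_add /= mul0r subr0.
Qed.

Lemma topcharge_trace x :
  (topcharge p x)%:C =
  2^-1 * 'i%C * (\tr (p x *m P1 x *m P2 x) - \tr (p x *m P2 x *m P1 x)).
Proof.
rewrite (topchargeE (projector_herm projp) (CkM_differentiable Cp1)).
have := dp_dm_commutator x; rewrite /commutator.
move: (dpM p x) (dmM p x) (P1 x) (P2 x) (p x) => U V A B Q E.
have T X Y : \tr (Q *m X - Q *m Y) = \tr (Q *m (X - Y)) by rewrite mulmxBr.
by rewrite -!mulmxA T E -scalemxAr mxtraceZ -T linearB.
Qed.

Lemma innerN (X Y : M) : inner (- X) Y = - inner X Y.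
Proof.
rewrite !innerE_rdot /rdot -[- X]scaleN1r -scalemxAl mxtraceZ mulN1r.
by case: (\tr _) => u v /=; ring.
Qed.

Lemma innerC (X Y : M) : inner X Y = inner Y X.
Proof. by rewrite !innerE_rdot rdotC. Qed.

Lemma innerZ (c : R) (X : M) :
  inner (c%:C *: X) (c%:C *: X) = - 2^-1 * (c ^+ 2 * rdot X X).
Proof.
rewrite innerE_rdot /rdot -scalemxAl -scalemxAr scalerA mxtraceZ -rmorphM /=.
by rewrite Re_mul /= mul0r subr0 expr2.
Qed.

Lemma rdot_herm_ge0 (X : M) : X ^t* = X -> 0 <= rdot X X.
Proof.
move=> hX; rewrite rdotE; apply: sumr_ge0 => j _; apply: sumr_ge0 => k _.
have -> : X k j = (X j k)^*%R by rewrite -[in LHS]hX !mxE.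
by case: (X j k) => u v /=; rewrite mulrN opprK -!expr2 addr_ge0 ?sqr_ge0.
Qed.

Section IsothermalChart.
Hypothesis confp : forall x,
  rdot (P1 x) (P1 x) = rdot (P2 x) (P2 x) /\ rdot (P1 x) (P2 x) = 0.

Lemma rdot_lagrangian x :
  rdot (P1 x) (P1 x) = 2 * lagrangian p x /\ rdot (P2 x) (P2 x) = 2 * lagrangian p x.
Proof.
have [E _] := confp x; have := lagrangian_real x; rewrite -E.
by set u := rdot _ _ => ->; split; field.
Qed.

Lemma Ck_lagrangian : Ck 2 (lagrangian p).
Proof.
have -> : lagrangian p = (fun=> 2^-1) \* (fun x => rdot (P1 x) (P1 x)).
  apply/funext => x; have [E _] := rdot_lagrangian x.
  by rewrite /= E mulKf // pnatr_eq0.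
exact: Ck_mul (Ck_cst _ _) (Ck_rdot (CkM_pdM 0 Cp) (CkM_pdM 0 Cp)).
Qed.

Lemma lagrangian_ge0 x : 0 <= lagrangian p x.
Proof.
have [E _] := rdot_lagrangian x.
have := rdot_herm_ge0 (pdM_herm Cp projp 0 x).
by rewrite E pmulr_rge0.
Qed.

Lemma fundform1_isothermal F : associated_surface p F ->
  fundform1 F = fun x => (lagrangian p x)%:M.
Proof.
move=> /surface_partials[F0 F1]; apply/funext => x.
have [E0 E1] := rdot_lagrangian x; have [_ E01] := confp x.
have n2 : (2 : R) != 0 by rewrite pnatr_eq0.
have i01 (i : 'I_2) : i = 0 \/ i = 1.
  by case: i => [[|[|//]] hi]; [left|right]; apply: val_inj.
apply/matrixP => i j; rewrite [LHS]mxE [RHS]mxE.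
case: (i01 i) => ->; case: (i01 j) => ->; rewrite ?F0 ?F1.
- by rewrite innerN innerC innerN opprK inner_commutators E1 mulKf.
- by rewrite innerN innerC inner_commutators E01 mulr0 oppr0.
- by rewrite innerC innerN innerC inner_commutators E01 mulr0 oppr0.
- by rewrite inner_commutators E0 mulKf.
Qed.

Lemma laplacian_normal F i x : associated_surface p F ->
  inner (pdM 0 (pdM 0 F) x + pdM 1 (pdM 1 F) x) (pdM i F x) = 0.
Proof.
move=> sF; rewrite (surface_laplacian x sF).
have [F0 F1] := surface_partials sF.
have i01 : i = 0 \/ i = 1.
  by case: i => [[|[|//]] hi]; [left|right]; apply: val_inj.
rewrite scaler_nat mulr2n innerDl.
case: i01 => ->; rewrite ?F0 ?F1; last by rewrite inner_commutator_tangent addr0.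
by rewrite innerC innerN innerC inner_commutator_tangent oppr0 addr0.
Qed.

Lemma mean_curvature_surface F x : associated_surface p F ->
  mean_curvature F x = (2 / lagrangian p x)%:C *: commutator (P1 x) (P2 x).
Proof.
move=> sF; have orth i := laplacian_normal i x sF.
rewrite (mean_curvature_conformal (fundform1_isothermal sF) orth).
rewrite (surface_laplacian x sF) scalerA; congr (_ *: _).
by rewrite rmorphM rmorph_nat mulrC.
Qed.

(** With s = tr (p P1 P2), conformality gives tr (p P2 P1) = - s, hence q = i s
    and s^2 = - q^2 in the formula for the trace of the squared commutator. *)
Lemma rdot_commutator_sq x :
  rdot (commutator (P1 x) (P2 x)) (commutator (P1 x) (P2 x)) =
  - (6 * topcharge p x ^+ 2 + 2 * lagrangian p x ^+ 2).
Proof.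
have [E1 E2] := rdot_lagrangian x; have [_ E12] := confp x.
have o1 := pdM_offdiagonal Cp projp 0 x; have o2 := pdM_offdiagonal Cp projp 1 x.
have QQ := projector_mul projp x; have tQ := projector_tr projp x.
have t11 := trace_real Cp projp 0 0 x; have t22 := trace_real Cp projp 1 1 x.
have t12 := trace_real Cp projp 0 1 x.
rewrite E1 rmorphM rmorph_nat in t11; rewrite E2 rmorphM rmorph_nat in t22.
rewrite E12 in t12.
have q := topcharge_trace x.
move: (P1 x) (P2 x) (p x) (topcharge p x) (lagrangian p x) o1 o2 QQ tQ q t11 t22 t12.
move=> A B Q u v o1 o2 QQ tQ q t11 t22 t12 {E1 E2 E12}.
have : \tr (Q *m B *m A) + \tr (Q *m A *m B) = 0.
  by rewrite addrC -(trace_offdiagonal_mul B o1).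
move/eqP; rewrite addr_eq0 => /eqP tBA; rewrite {}tBA in q.
rewrite /rdot /commutator (trace_commutator_sq QQ tQ o1 o2 t11 t22 t12).
have -> : \tr (Q *m A *m B) = - 'i%C * u%:C.
  rewrite q; move: (\tr _) => s.
  transitivity (- 'i%C ^+ 2 * s); last by field.
  by rewrite sqr_i opprK mul1r.
rewrite exprMn sqrrN sqr_i mulN1r -!rmorphXn /=.
ring.
Qed.

End IsothermalChart.

End Surface.

(** * The theorem *)

Section SphereDecay.
Variables (R : realType) (N : nat) (P : sphere R -> 'M[R[i]]_N).

Lemma pdM_vanishes i j k : CkSphere 3 P ->
  vanishes_at_infinity (fun x => complex.Re (pdM i (P \o @chart0 R) x j k)) /\
  vanishes_at_infinity (fun x => complex.Im (pdM i (P \o @chart0 R) x j k)).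
Proof.
move=> [_ /(_ j k)[Cr Ci]].
have ext y : y != 0 -> (P \o @chart0 R) y = (P \o @chartoo R) (inversion y).
  by move=> y0; rewrite /= inversion_chartoo.
split.
  under eq_fun do rewrite pdM_entry.
  by apply: (pdR_vanishes i (CkW (CkW Cr))) => y /ext ->.
under eq_fun do rewrite pdM_entry.
by apply: (pdR_vanishes i (CkW (CkW Ci))) => y /ext ->.
Qed.

End SphereDecay.

Theorem mainTheorem7 (R : realType) (N : nat) (P : sphere R -> 'M[R[i]]_N)
  (F : R * R -> 'M[R[i]]_N) :
  let p := P \o @chart0 R in
  CkSphere 3 P ->
  (forall z, rank1_projector (P z)) ->
  euler_lagrange p ->
  (action p < +oo)%E ->
  associated_surface p F ->
  forall x : R * R, lagrangian p x != 0 ->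
  [/\ (gauss_curvature F x)%:C =
        - (2%:R * dpC (dmC (fun y => (ln (lagrangian p y))%:C)) x)
          / (lagrangian p x)%:C,
      mean_curvature F x =
        (- 4%:R * 'i%C / (lagrangian p x)%:C)
          *: commutator (dpM p x) (dmM p x) &
      inner (mean_curvature F x) (mean_curvature F x) =
        4%:R / lagrangian p x ^+ 2
          * (lagrangian p x ^+ 2 + 3%:R * topcharge p x ^+ 2)].
Proof.
move=> p smooth proj EL _ sF x Lx0.
have Cp : CkM 3 p := proj1 smooth.
have projp y : rank1_projector (p y) := proj (Some y).
have van i j k := @pdM_vanishes R N P i j k smooth.
have conf y : rdot (pdM 0 p y) (pdM 0 p y) = rdot (pdM 1 p y) (pdM 1 p y) /\
    rdot (pdM 0 p y) (pdM 1 p y) = 0.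
  apply: (hopf_differential_eq0 (CkM_pdM 0 Cp) (CkM_pdM 1 Cp)).
  - by move=> z; apply: schwarzM; apply: CkM_W.
  - exact: (laplacian_orth Cp projp EL 0).
  - exact: (laplacian_orth Cp projp EL 1).
  - exact: (van 0).
  - exact: (van 1).
have CL := Ck_lagrangian Cp conf.
have Lx : 0 < lagrangian p x.
  by rewrite lt_def Lx0 (lagrangian_ge0 Cp projp conf).
have HE := mean_curvature_surface Cp projp conf x sF.
split.
- rewrite /gauss_curvature (fundform1_isothermal Cp projp conf sF).
  rewrite (gauss_curvature_conformal CL Lx0) (dpC_dmC_ln CL Lx).
  move: (pdR 0 _ x + pdR 1 _ x) (lagrangian p x) Lx0 => u l l0.
  rewrite -(rmorph_nat (real_complex R)) -rmorphM -rmorphN -fmorphV -rmorphM /=.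
  by congr (_%:C); field; exact: l0.
- rewrite HE (dp_dm_commutator p x) scalerA; congr (_ *: _).
  move: (lagrangian p x) Lx0 => l l0.
  have lC0 : l%:C != 0 by rewrite fmorph_eq0.
  rewrite rmorphM rmorph_nat fmorphV /=.
  transitivity (- 2 * 'i%C ^+ 2 / l%:C); first by rewrite sqr_i mulrNN mulr1.
  by field; exact: lC0.
- rewrite HE innerZ (rdot_commutator_sq Cp projp conf).
  move: (lagrangian p x) (topcharge p x) Lx0 => l q l0.
  by field; exact: l0.
Qed.
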